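(* Let $G$ be a discrete group acting by homeomorphisms on a compact metrizable space $X$, let $p\geq 1$, and let $\mu$ be a Borel probability measure on $X$ with full support which has $\ell^p$-deviation. Let $A_p(X)=\{\phi\in C(X):\sigma_G\phi\in\ell^pG\}$, let $n$ be an odd positive integer with $n+1>p$, and let $$\Phi(a^0,a^1,\dots,a^n)=\mathrm{Tr}\Big((2P_{\ell^2G}-1)[P_{\ell^2G},\lambda_\mu(a^0)][P_{\ell^2G},\lambda_\mu(a^1)]\cdots[P_{\ell^2G},\lambda_\mu(a^n)]\Big)$$ be the cyclic $n$-cocycle representing Connes' Chern character of the $p$-summable Fredholm module $(\lambda_\mu,P_{\ell^2G})$. Let $\phi_0,\dots,\phi_n\in A_p(X)$ and $g_0,\dots,g_n\in G$. If $g_0g_1\cdots g_n\neq 1$ in $G$, then $\Phi(\phi_0g_0,\phi_1g_1,\dots,\phi_ng_n)=0$. If $g_0g_1\cdots g_n=1$ in $G$, then $$(-1)^{\frac{n+1}{2}}\Phi(\phi_0g_0,\dots,\phi_ng_n)=\sum_{h\in G}\Big(\mathrm{cov}_G(\psi_0,\psi_1^* )\,\mathrm{cov}_G(\psi_2,\psi_3^* )\cdots\mathrm{cov}_G(\psi_{n-1},\psi_n^* )\Big)(h)-\sum_{h\in G}\Big(\mathrm{cov}_G(\psi_n,\psi_0^* )\,\mathrm{cov}_G(\psi_1,\psi_2^* )\cdots\mathrm{cov}_G(\psi_{n-2},\psi_{n-1}^* )\Big)(h),$$ where $\psi_0:=\phi_0$, $\psi_1:=g_0.\phi_1$, $\psi_2:=g_0g_1.\phi_2$,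 $\dots$, $\psi_n:=g_0g_1\cdots g_{n-1}.\phi_n$.
   Context: Notation: $(g.\phi)(x)=\phi(g^{-1}x)$ and $\phi^*=\bar\phi$. The regular representation $\lambda_\mu$ of the reduced crossed product $C(X)\rtimes_{\mathrm r}G$ on $\ell^2(G,L^2(X,\mu))$ is given by $\lambda_\mu(\phi)(\sum\psi_h\delta_h)=\sum(h^{-1}.\phi)\psi_h\delta_h$ and $\lambda_\mu(g)(\sum\psi_h\delta_h)=\sum\psi_h\delta_{gh}$. $P_{\ell^2G}$ is the projection onto the constant-coefficient subspace $\ell^2G$: $P_{\ell^2G}(\sum\psi_h\delta_h)=\sum(\int\psi_h\,d\mu)\delta_h$. For $\phi\in C(X)$ the $G$-expectation and $G$-deviation are the functions on $G$ given by $E_G(\phi)(g)=\int g^{-1}.\phi\,d\mu=\int\phi\,dg_*\mu$ and $\sigma_G(\phi)=\sqrt{E_G(|\phi|^2)-|E_G(\phi)|^2}$. The $G$-covariance of $\phi,\psi\in C(X)$ is the function $\mathrm{cov}_G(\phi,\psi)=E_G(\phi\psi^* )-E_G(\phi)E_G(\psi^* )$ on $G$. The measure $\mu$ has $\ell^p$-deviation if $\sigma_G(\phi)\in\ell^pG$ for all $\phi$ in a dense subalgebra of $C(X)$; then $A_p(X)$ is a dense $G$-invariant $*$-subalgebra of $C(X)$, and $(\lambda_\mu,P_{\ell^2G})$ is a $p$-summable Fredholm module, with $[P_{\ell^2G},\lambda_\mu(a)]\in\mathcal L^p$ for $a$ in the algebraic crossed product $A_p(X)\rtimes_{\mathrm{alg}}G$.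 The elements $\phi_ig_i$ are the basic elements of $A_p(X)\rtimes_{\mathrm{alg}}G$. *)

(* Defs.v *)
From HB Require Import structures.
From mathcomp Require Import all_boot all_order all_algebra complex finmap.
From mathcomp Require Import all_classical all_reals all_analysis.
From mathcomp.analysis.showcase Require summability.

Set Implicit Arguments.
Unset Strict Implicit.
Unset Printing Implicit Defensive.

Import Order.TTheory GRing.Theory Num.Theory.
Import numFieldNormedType.Exports.

Local Open Scope classical_set_scope.
Local Open Scope ring_scope.

(* R[i] with its structure of numClosedFieldType; its topology is the one of
   its norm. *)
Definition cplx (R : realType) : numClosedFieldType := R[i].

Definition re (R : realType) (z : cplx R) : R := complex.Re z.
Definition im (R : realType) (z : cplx R) : R := complex.Im z.

Definition metrizable (R : realType) (X : topologicalType) : Prop :=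
  exists d : X -> X -> R,
    [/\ forall x y, d x y = 0 <-> x = y,
        forall x y, d x y = d y x,
        forall x y z, d x z <= d x y + d y z &
        forall x (U : set X), nbhs x U <->
          exists2 e : R, 0 < e & [set y | d x y < e] `<=` U].

(* Each [act g] is a homeomorphism: its inverse is [act g^-1]. *)
Definition action_by_homeo (G : groupType) (X : topologicalType)
    (act : G -> X -> X) : Prop :=
  [/\ forall x, act 1%g x = x,
      forall g h x, act (g * h)%g x = act g (act h x) &
      forall g, continuous (act g)].

(* X with its Borel sigma-algebra. Measurable types are pointed, hence the
   pointed X; a space carrying a probability measure is nonempty anyway. *)
Notation borel X := (g_sigma_algebraType (@open X)).

Definition full_support (R : realType) (X : ptopologicalType)
    (mu : probability (borel X) R) : Prop :=
  forall U : set X, open U -> U !=set0 -> (0 < mu U)%E.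

(* Unordered sums of complex families, over the finite subsets of the index
   type; [csum f] is only meaningful when [csummable f]. *)
Definition csum_to (R : realType) (I : choiceType) (f : I -> cplx R)
    (z : cplx R) : Prop :=
  summability.partial_sum f @ summability.totally --> z.

Definition csummable (R : realType) (I : choiceType) (f : I -> cplx R) : Prop :=
  exists z, csum_to f z.

Definition csum (R : realType) (I : choiceType) (f : I -> cplx R) : cplx R :=
  @summability.sum I (cplx R) (cplx R)^o f.

Definition ellp (R : realType) (G : choiceType) (p : R) (f : G -> cplx R) :
    Prop :=
  (\esum_(g in [set: G]) (re `|f g| `^ p)%:E < +oo)%E.

Section crossed_product.
Variables (R : realType) (G : groupType) (X : ptopologicalType).
Variables (act : G -> X -> X) (mu : probability (borel X) R).
Local Notation C := (cplx R).

Definition cintegral (f : X -> C) : C :=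
  Complex (Rintegral mu setT (fun x : borel X => re (f x)))
          (Rintegral mu setT (fun x : borel X => im (f x))).

Definition translate (g : G) (phi : X -> C) : X -> C :=
  fun x => phi (act g^-1%g x).

Definition cconj (phi : X -> C) : X -> C := fun x => (phi x)^*.

Definition expG (phi : X -> C) : G -> C :=
  fun g => cintegral (translate g^-1%g phi).

Definition devG (phi : X -> C) : G -> C :=
  fun g => sqrtC (expG (fun x => `|phi x| ^+ 2) g - `|expG phi g| ^+ 2).

Definition covG (phi psi : X -> C) : G -> C :=
  fun g => expG (fun x => phi x * cconj psi x) g - expG phi g * expG (cconj psi) g.

Definition dense_subalgebra (A : set (X -> C)) : Prop :=
  [/\ forall f, A f -> continuous f,
      forall f g, A f -> A g -> A (fun x => f x + g x),
      forall c f, A f -> A (fun x => c * f x),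
      forall f g, A f -> A g -> A (fun x => f x * g x) &
      forall (f : X -> C) (e : R), continuous f -> 0 < e ->
        exists2 a, A a & forall x, re `|f x - a x| < e].

Definition ellp_deviation (p : R) : Prop :=
  exists2 A : set (X -> C), dense_subalgebra A &
    forall phi, A phi -> ellp p (devG phi).

Definition Ap (p : R) : set (X -> C) :=
  [set phi | continuous phi /\ ellp p (devG phi)].

(* The Hilbert space l^2(G, L^2(X, mu)). A vector sum_h psi_h delta_h is
   represented by a family h |-> psi_h of functions. Two families stand for the
   same vector when they agree mu-a.e. for every h, that is when their
   difference v satisfies [dot v v = 0]; operators act on representatives. *)
Definition vec : Type := G -> X -> C.

Definition ell2 : set vec :=
  [set psi |
    (forall h, measurable_fun setT (fun x : borel X => re (psi h x)) /\
               measurable_fun setT (fun x : borel X => im (psi h x))) /\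
    (\esum_(h in [set: G])
       \int[mu]_(x in setT) (re (`|psi h x| ^+ 2))%:E < +oo)%E].

(* Linear on the left. *)
Definition dot (psi xi : vec) : C :=
  csum (fun h => cintegral (fun x => psi h x * (xi h x)^*)).

Definition orthonormal_basis (I : choiceType) (e : I -> vec) : Prop :=
  [/\ forall i, ell2 (e i),
      forall i j, dot (e i) (e j) = (i == j)%:R &
      forall v, ell2 v -> (forall i, dot v (e i) = 0) -> dot v v = 0].

Definition bounded_operator (T : vec -> vec) : Prop :=
  [/\ forall v, ell2 v -> ell2 (T v),
      forall c u v, ell2 u -> ell2 v ->
        let w : vec := fun h x =>
          T (fun h x => c * u h x + v h x) h x - (c * T u h x + T v h x) in
        dot w w = 0 &
      exists M : R, forall v, ell2 v ->
        re (dot (T v) (T v)) <= M * re (dot v v)].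

(* A = |T|: A is positive and A^2 = T^* T. *)
Definition is_absolute_value (T A : vec -> vec) : Prop :=
  [/\ bounded_operator A,
      forall v, ell2 v -> 0 <= dot (A v) v &
      forall u v, ell2 u -> ell2 v -> dot (A (A u)) v = dot (T u) (T v)].

Definition trace_class (T : vec -> vec) : Prop :=
  bounded_operator T /\
  exists2 A, is_absolute_value T A &
    exists (I : choiceType) (e : I -> vec), orthonormal_basis e /\
      (\esum_(i in [set: I]) (re (dot (A (e i)) (e i)))%:E < +oo)%E.

(* The common value of sum_i <T e_i, e_i> over all orthonormal bases e. *)
Definition trace (T : vec -> vec) : C :=
  xget 0 [set z | forall (I : choiceType) (e : I -> vec),
    orthonormal_basis e -> csum_to (fun i => dot (T (e i)) (e i)) z].

Definition lambda_fun (phi : X -> C) (psi : vec) : vec :=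
  fun h x => translate h^-1%g phi x * psi h x.

Definition lambda_grp (g : G) (psi : vec) : vec := fun k => psi (g^-1 * k)%g.

(* Elements sum_g a_g g of the algebraic crossed product, as finitely
   supported functions g |-> a_g; that the a_g are in A_p is a separate
   condition. *)
Definition crossed : Type := {fsfun G -> (X -> C) with 0}.

Definition basic (phi : X -> C) (g : G) : crossed :=
  [fsfun _ in [fset g]%fset => phi].

Definition lambda_mu (a : crossed) (psi : vec) : vec :=
  fun h x => \sum_(g <- finsupp a) lambda_fun (a g) (lambda_grp g psi) h x.

Definition projG (psi : vec) : vec := fun h _ => cintegral (psi h).

Definition commutator (S T : vec -> vec) : vec -> vec :=
  fun psi h x => S (T psi) h x - T (S psi) h x.

Definition symG (psi : vec) : vec := fun h x => projG psi h x *+ 2 - psi h x.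

Definition chern_operator (n : nat) (a : 'I_n.+1 -> crossed) : vec -> vec :=
  symG \o \big[(fun S T : vec -> vec => S \o T)/id]_(i < n.+1)
            commutator projG (lambda_mu (a i)).

Definition chern (n : nat) (a : 'I_n.+1 -> crossed) : C :=
  trace (chern_operator a).

(* psi_i = g_0 ... g_(i-1) . phi_i *)
Definition shifted (n : nat) (phi : 'I_n.+1 -> X -> C) (g : 'I_n.+1 -> G)
    (i : nat) : X -> C :=
  translate (\prod_(j < n.+1 | (j < i)%N) g j)%g (phi (inord i)).

End crossed_product.

(* Main.v *)
(* Every operator involved is fibred over G up to a translation of G. At h in G,
   with F_i = psi_i o h, the commutator [P, lambda(psi_i)] acts on L^2(X, mu) as
   y |-> int(F_i y) - F_i int y = int(f_i y) - f_i int y, where f_i = F_i - int F_i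
   has mean 0. It exchanges the constants and their orthogonal complement, so an
   even product of such commutators is, up to sign, the rank two operator
     y |-> c_01 c_23 ... c_(n-1)n int y + f_0 c_12 ... c_(n-2)(n-1) int(f_n y),
   where c_ij = int(f_i f_j) = cov(psi_i, psi_j^* )(h); the factor 2P - 1 changes
   the sign of the second term. The trace of the total operator is the sum over h
   of the traces of these fibres when g_0 ... g_n = 1, and 0 otherwise because the
   fibres are then moved off the diagonal. Cauchy-Schwarz bounds the fibres by the
   product of the n+1 deviations at h, which is summable since p <= n+1. The
   modulus of an orthogonal sum of rank one operators <-, w> u is the sum of the
   (|u| / |w|) <-, w> w, which gives the trace class property. *)

Require Import Defs.
From HB Require Import structures.
From mathcomp Require Import all_boot all_order all_algebra complex finmap.
From mathcomp Require Import all_classical all_reals all_analysis.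
From mathcomp.analysis.showcase Require summability.
From mathcomp Require Import measurable_realfun.
From mathcomp Require Import ring lra.

Set Implicit Arguments.
Unset Strict Implicit.
Unset Printing Implicit Defensive.

Import Order.TTheory GRing.Theory Num.Theory.
Import numFieldNormedType.Exports.

Local Open Scope classical_set_scope.
Local Open Scope ring_scope.

(** * Complex numbers *)

(** Nothing is quotiented: vectors are representatives and the inner product is only semidefinite,
    so Cauchy-Schwarz must also cover null vectors, and equality of vectors becomes vanishing of the
    norm of a difference. [G] may be uncountable, so bases are not enumerated and sums are
    unordered. The work behind the word trace is its independence of the basis. For one rank one
    term it is Parseval's identity for a maximal orthonormal family, which rests on the completeness
    of [ell2]; summing over [h] then requires Fubini for unordered sums, whose hypothesis is a
    Bessel bound by products of norms. Some basis must also exist (Zorn): otherwise the condition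
    that defines [trace] would hold for every number. The modulus is built on the source side, where
    the translation by [g_0 ... g_n] disappears, so the trace class property holds whatever that
    product is. The two rank one terms of a fibre do not interact, because constants are orthogonal
    to functions of mean zero, both among the ranges and among the functionals. *)

Section complex_numbers.
Variable R : realType.
Local Notation C := (cplx R).
Implicit Types z w : C.

Definition rc (x : R) : C := Complex x 0.

Lemma cplxP z w : re z = re w -> im z = im w -> z = w.
Proof. by case: z => a b; case: w => c d /= -> ->. Qed.
Lemma re_rc x : re (rc x) = x. Proof. by []. Qed.
Lemma im_rc x : im (rc x) = 0. Proof. by []. Qed.
Lemma reD z w : re (z + w) = re z + re w. Proof. by case: z; case: w. Qed.
Lemma imD z w : im (z + w) = im z + im w. Proof. by case: z; case: w. Qed.
Lemma reN z : re (- z) = - re z. Proof. by case: z. Qed.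
Lemma imN z : im (- z) = - im z. Proof. by case: z. Qed.
Lemma reM z w : re (z * w) = re z * re w - im z * im w.
Proof. by case: z; case: w. Qed.
Lemma imM z w : im (z * w) = re z * im w + im z * re w.
Proof. by case: z => a b; case: w => c d. Qed.
Lemma re_conj z : re z^* = re z. Proof. by case: z. Qed.
Lemma im_conj z : im z^* = - im z. Proof. by case: z. Qed.

Lemma rcD x y : rc (x + y) = rc x + rc y.
Proof. by apply: cplxP; rewrite ?reD ?imD //= addr0. Qed.
Lemma rcN x : rc (- x) = - rc x.
Proof. by apply: cplxP; rewrite ?reN ?imN //= oppr0. Qed.
Lemma rcM x y : rc (x * y) = rc x * rc y.
Proof. by apply: cplxP; rewrite ?reM ?imM /=; ring. Qed.
Lemma rcX x n : rc (x ^+ n) = rc x ^+ n.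
Proof. by elim: n => // n IH; rewrite !exprS rcM IH. Qed.
Lemma rc_sum (I : Type) (r : seq I) (F : I -> R) :
  rc (\sum_(i <- r) F i) = \sum_(i <- r) rc (F i).
Proof. by elim/big_rec2: _ => [//|i x y _ <-]; rewrite rcD. Qed.
Lemma rc_inj x y : rc x = rc y -> x = y. Proof. by move=> []. Qed.

Lemma cplxE z : z = rc (re z) + 'i * rc (im z).
Proof. by rewrite -complexiE {1}(complexE z). Qed.

Lemma re_i : re ('i : C) = 0. Proof. by rewrite -(complexiE R). Qed.
Lemma im_i : im ('i : C) = 1. Proof. by rewrite -(complexiE R). Qed.

Lemma ler_rc x y : (rc x <= rc y) = (x <= y). Proof. exact: lecR. Qed.
Lemma ltr_rc x y : (rc x < rc y) = (x < y). Proof. exact: ltcR. Qed.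
Lemma rc_ge0 x : (0 <= rc x) = (0 <= x). Proof. exact: ler0c. Qed.

(** The norm of [cplx R] takes its values in [cplx R]; estimates, [esum] and integrals call for a
    real modulus. *)
Definition cabs z : R := re `|z|.

Lemma normcE z : `|z| = rc (cabs z). Proof. by rewrite /cabs normc_def. Qed.
Lemma cabsE z : cabs z = Num.sqrt (re z ^+ 2 + im z ^+ 2).
Proof. by rewrite /cabs /re normc_def. Qed.
Lemma cabs_ge0 z : 0 <= cabs z. Proof. by rewrite cabsE sqrtr_ge0. Qed.
Lemma cabsM z w : cabs (z * w) = cabs z * cabs w.
Proof. by apply: rc_inj; rewrite rcM -!normcE normrM. Qed.
Lemma cabsD z w : cabs (z + w) <= cabs z + cabs w.
Proof. by rewrite -ler_rc rcD -!normcE ler_normD. Qed.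
Lemma cabsN z : cabs (- z) = cabs z.
Proof. by rewrite /cabs normrN. Qed.
Lemma cabsX z n : cabs (z ^+ n) = cabs z ^+ n.
Proof. by apply: rc_inj; rewrite rcX -!normcE normrX. Qed.
Lemma cabs0 : cabs 0 = 0. Proof. by rewrite /cabs normr0. Qed.
Lemma cabs1 : cabs 1 = 1. Proof. by rewrite /cabs normr1. Qed.
Lemma cabs_eq0 z : cabs z = 0 -> z = 0.
Proof. by move=> h; apply/normr0_eq0; rewrite normcE h. Qed.
Lemma cabs_rc x : cabs (rc x) = `|x|.
Proof. by rewrite cabsE /= expr0n addr0 sqrtr_sqr. Qed.
Lemma cabs_conj z : cabs z^* = cabs z.
Proof. by rewrite !cabsE re_conj im_conj sqrrN. Qed.
Lemma cabsi : cabs 'i = 1.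
Proof. by apply: rc_inj; rewrite -normcE normCi. Qed.
Lemma cabs_sqr z : cabs z ^+ 2 = re z ^+ 2 + im z ^+ 2.
Proof. by rewrite cabsE sqr_sqrtr ?addr_ge0 ?sqr_ge0. Qed.
Lemma re_norm_sqr z : re (`|z| ^+ 2) = cabs z ^+ 2.
Proof. by rewrite normcE -rcX. Qed.
Lemma mul_conj z : z * z^* = rc (cabs z ^+ 2).
Proof. by rewrite -normCK normcE rcX. Qed.
Lemma conjM z w : (z * w)^* = z^* * w^*. Proof. exact: rmorphM. Qed.
Lemma conjD z w : (z + w)^* = z^* + w^*. Proof. exact: rmorphD. Qed.
Lemma conjN z : (- z)^* = - z^*. Proof. exact: rmorphN. Qed.
Lemma conj_rc x : (rc x)^* = rc x.
Proof. by apply: cplxP; rewrite ?re_conj ?im_conj ?oppr0. Qed.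
Lemma re_le_cabs z : `|re z| <= cabs z.
Proof.
rewrite -(@ler_pXn2r _ 2) ?nnegrE ?cabs_ge0 ?normr_ge0 // cabs_sqr.
by rewrite real_normK ?num_real // lerDl sqr_ge0.
Qed.
Lemma im_le_cabs z : `|im z| <= cabs z.
Proof.
rewrite -(@ler_pXn2r _ 2) ?nnegrE ?cabs_ge0 ?normr_ge0 // cabs_sqr.
by rewrite real_normK ?num_real // lerDr sqr_ge0.
Qed.
Lemma cabs_le z : cabs z <= `|re z| + `|im z|.
Proof.
rewrite {1}(cplxE z) (le_trans (cabsD _ _)) // cabsM cabsi mul1r !cabs_rc //.
Qed.
Lemma ge0_rc z : 0 <= z -> z = rc (re z).
Proof. by move=> z0; apply: cplxP => //; apply: ger0_Im. Qed.
Lemma sum_cabs (I : Type) (r : seq I) (F : I -> C) :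
  cabs (\sum_(i <- r) F i) <= \sum_(i <- r) cabs (F i).
Proof.
elim/big_rec2: _ => [|i x y _ h]; first by rewrite cabs0.
by rewrite (le_trans (cabsD _ _)) // lerD2l.
Qed.
Lemma prod_cabs (I : Type) (r : seq I) (F : I -> C) :
  cabs (\prod_(i <- r) F i) = \prod_(i <- r) cabs (F i).
Proof. by elim/big_rec2: _ => [|i x y _ <-]; rewrite ?cabs1 ?cabsM. Qed.

End complex_numbers.

(** * Unordered sums *)

Section unordered_sums.
Variable R : realType.
Local Notation C := (cplx R).

Definition asum (I : choiceType) (f : I -> C) : \bar R :=
  \esum_(i in [set: I]) (cabs (f i))%:E.
Definition asummable (I : choiceType) (f : I -> C) : Prop := (asum f < +oo)%E.

Section one_family.
Variable I : choiceType.
Implicit Types (f g : I -> C) (a : I -> R).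

Lemma csum_toP f z : csum_to f z <->
  forall e : R, 0 < e -> exists F : {fset I}, forall J : {fset I},
    (F `<=` J)%fset -> cabs (z - \sum_(i <- J) f i) < e.
Proof.
have Ft : Filter (@summability.totally I).
  exact: (@filter_filter _ _ (@summability.totally_filter I)).
split.
  move=> /(@cvgr_dist_lt _ (cplx R)^o) h e e0.
  have := h (rc e); rewrite ltr_rc => /(_ e0) [F _ FP].
  exists F => J FJ; have /= := FP J FJ.
  rewrite /summability.partial_sum (big_seq_fsetE _ J predT f) /=.
  by rewrite normcE ltr_rc.
move=> h; apply/(@cvgrPdist_lt _ (cplx R)^o) => e e0.
(* A positive element of [cplx R] is real, so every tolerance of the topology comes from a real
   one. *)
have eE : e = rc (re e) by apply: ge0_rc; apply: ltW.
have [|F FP] := h (re e); first by rewrite -ltr_rc -eE.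
exists F => // J FJ /=.
rewrite /summability.partial_sum eE normcE ltr_rc.
by have := FP J FJ; rewrite (big_seq_fsetE _ J predT f).
Qed.

Lemma csum_to_csum f z : csum_to f z -> csum f = z.
Proof.
by move=> h; exact: (@cvg_lim (cplx R)^o (@norm_hausdorff _ (cplx R)^o)
  _ _ (@summability.totally_filter I) _ _ h).
Qed.

Lemma csum_to_unique f z w : csum_to f z -> csum_to f w -> z = w.
Proof. by move=> /csum_to_csum <- /csum_to_csum <-. Qed.

Lemma csum_toD f g z w : csum_to f z -> csum_to g w ->
  csum_to (fun i => f i + g i) (z + w).
Proof.
move=> /csum_toP hf /csum_toP hg; apply/csum_toP => e e0.
have [|F hF] := hf (e / 2); first by rewrite divr_gt0.
have [|K hK] := hg (e / 2); first by rewrite divr_gt0.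
exists (F `|` K)%fset => J; rewrite fsubUset => /andP[/hF h1 /hK h2].
rewrite big_split /= opprD addrACA (le_lt_trans (cabsD _ _)) //.
by rewrite (splitr e) ltrD.
Qed.

Lemma csum_toZ c f z : csum_to f z -> csum_to (fun i => c * f i) (c * z).
Proof.
move=> /csum_toP hf; apply/csum_toP => e e0.
have c0 : 0 < cabs c + 1 by rewrite ltr_wpDl ?cabs_ge0.
have [|F hF] := hf (e / (cabs c + 1)); first by rewrite divr_gt0.
exists F => J /hF h.
rewrite -mulr_sumr -mulrBr cabsM.
apply: (@le_lt_trans _ _ ((cabs c + 1) * cabs (z - \sum_(i <- J) f i))).
  by rewrite ler_wpM2r ?cabs_ge0 // lerDl.
by rewrite mulrC -ltr_pdivlMr.
Qed.

Arguments csum_toZ c {f z}.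

Lemma csum_to_conj f z : csum_to f z -> csum_to (fun i => (f i)^*) z^*.
Proof.
move=> /csum_toP hf; apply/csum_toP => e /hf[F hF]; exists F => J /hF.
by rewrite -rmorph_sum -rmorphB cabs_conj.
Qed.

Lemma csum_to0 : csum_to (fun _ : I => 0 : C) 0.
Proof.
by apply/csum_toP => e e0; exists fset0 => J _; rewrite big1 // subr0 cabs0.
Qed.

Lemma csum_to_le f z (M : R) : csum_to f z ->
  (forall J : {fset I}, cabs (\sum_(i <- J) f i) <= M) -> cabs z <= M.
Proof.
move=> /csum_toP hf hM; apply/ler_addgt0Pr => e e0.
have [F /(_ F (fsubset_refl _)) h] := hf e e0.
rewrite -(subrK (\sum_(i <- F) f i) z) (le_trans (cabsD _ _)) // addrC.
by rewrite lerD // ltW.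
Qed.

(* Meant for nonnegative summable families; 0 when the sum diverges. *)
Definition rsum a : R := fine (\esum_(i in [set: I]) (a i)%:E).

Lemma esum_leP a (M : R) : (forall J : {fset I}, \sum_(i <- J) a i <= M) ->
  (\esum_(i in [set: I]) (a i)%:E <= M%:E)%E.
Proof.
move=> h; apply: ge_ereal_sup => _ [A [finA _] <-].
by rewrite fsbig_finite // sumEFin lee_fin.
Qed.

Lemma sum_le_esum a (J : {fset I}) :
  ((\sum_(i <- J) a i)%:E <= \esum_(i in [set: I]) (a i)%:E)%E.
Proof.
apply: ereal_sup_ubound; exists [set` J]; first by split.
by rewrite fsbig_finite // set_fsetK sumEFin.
Qed.

Section nonnegative.
Variable a : I -> R.
Hypothesis a0 : forall i, 0 <= a i.
Hypothesis afin : (\esum_(i in [set: I]) (a i)%:E < +oo)%E.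

Lemma rsumE : (\esum_(i in [set: I]) (a i)%:E)%E = (rsum a)%:E.
Proof.
by rewrite fineK // ge0_fin_numE // esum_ge0 // => i _; rewrite lee_fin.
Qed.

Lemma rsum_ge0 : 0 <= rsum a.
Proof. by rewrite fine_ge0 // esum_ge0 // => i _; rewrite lee_fin. Qed.

Lemma sum_le_rsum (J : {fset I}) : \sum_(i <- J) a i <= rsum a.
Proof. by rewrite -lee_fin -rsumE sum_le_esum. Qed.

Lemma le_rsum i : a i <= rsum a.
Proof. by have := sum_le_rsum [fset i]%fset; rewrite big_seq_fset1. Qed.

Lemma rsum_approx (e : R) : 0 < e ->
  exists F : {fset I}, rsum a - e < \sum_(i <- F) a i.
Proof.
move=> e0.
have : ((rsum a - e)%:E < \esum_(i in [set: I]) (a i)%:E)%E.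
  by rewrite rsumE lte_fin ltrBlDr ltrDl.
move=> /ereal_sup_gt[_ [A [finA _] <-]].
by rewrite fsbig_finite // sumEFin lte_fin => h; exists (fset_set A).
Qed.

(** Partial sums grow with the finite set, so all those beyond one that is [e]-close to the supremum
    are [e]-close too. *)
Lemma csum_to_rsum : csum_to (fun i => rc (a i)) (rc (rsum a)).
Proof.
apply/csum_toP => e e0; have [F hF] := rsum_approx e0.
exists F => J FJ; rewrite -rc_sum -rcN -rcD cabs_rc ger0_norm ?subr_ge0 ?sum_le_rsum //.
rewrite ltrBlDr -ltrBlDl (lt_le_trans hF) //.
rewrite (big_fsetID _ (mem F) J) /=.
rewrite (_ : [fset x in J | x \in mem F]%fset = F); last first.
  apply/fsetP => x; rewrite !inE /= andbC; case: (boolP (x \in F)) => //= xF.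
  exact: (fsubsetP FJ).
by rewrite lerDl sumr_ge0.
Qed.
End nonnegative.

Lemma esum_lty a b : (forall i, a i <= b i) ->
  (\esum_(i in [set: I]) (b i)%:E < +oo)%E ->
  (\esum_(i in [set: I]) (a i)%:E < +oo)%E.
Proof. by move=> ab; apply: le_lt_trans; apply: le_esum => i _; rewrite lee_fin. Qed.

Lemma esum_ltyD a b : (forall i, 0 <= a i) -> (forall i, 0 <= b i) ->
  (\esum_(i in [set: I]) (a i)%:E < +oo)%E ->
  (\esum_(i in [set: I]) (b i)%:E < +oo)%E ->
  (\esum_(i in [set: I]) (a i + b i)%:E < +oo)%E.
Proof.
move=> a0 b0 ha hb; under eq_esum do rewrite EFinD.
by rewrite esumD ?lte_add_pinfty // => i _; rewrite lee_fin.
Qed.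

Lemma esum_ltyZ a (c : R) : 0 <= c -> (forall i, 0 <= a i) ->
  (\esum_(i in [set: I]) (a i)%:E < +oo)%E ->
  (\esum_(i in [set: I]) (c * a i)%:E < +oo)%E.
Proof.
move=> c0 a0 ha; apply: (@le_lt_trans _ _ (c * rsum a)%:E); last exact: ltry.
apply: esum_leP => J; rewrite -mulr_sumr ler_wpM2l //; exact: sum_le_rsum.
Qed.

Lemma asummable_le f a : (forall i, cabs (f i) <= a i) ->
  (\esum_(i in [set: I]) (a i)%:E < +oo)%E -> asummable f.
Proof. exact: esum_lty. Qed.

Lemma asummableD f g : asummable f -> asummable g ->
  asummable (fun i => f i + g i).
Proof.
move=> hf hg; apply: (@asummable_le _ (fun i => cabs (f i) + cabs (g i))).
  by move=> i; apply: cabsD.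
by apply: esum_ltyD => // i; apply: cabs_ge0.
Qed.

Lemma asummableZ c f : asummable f -> asummable (fun i => c * f i).
Proof.
move=> hf; apply: (@asummable_le _ (fun i => cabs c * cabs (f i))).
  by move=> i; rewrite cabsM.
by apply: esum_ltyZ => // [|i]; apply: cabs_ge0.
Qed.

Arguments asummableZ c {f}.

Lemma asummable_conj f : asummable f -> asummable (fun i => (f i)^*).
Proof. by apply: asummable_le => i; rewrite cabs_conj. Qed.

(* A complex family is a linear combination of the positive and negative parts
   of its two coordinates. *)
Lemma asum_ind (P : (I -> C) -> Prop) f :
  (forall a, (forall i, 0 <= a i) -> (forall i, a i <= cabs (f i)) ->
     P (fun i => rc (a i))) ->
  (forall c g h, P g -> P h -> P (fun i => c * g i + h i)) ->
  P f.
Proof.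
move=> Prc Plin.
pose pos (r : R) := Num.max r 0.
have posE r : r = pos r - pos (- r).
  rewrite /pos; case: (leP r 0) => r0.
    by rewrite max_l ?oppr_ge0 // sub0r opprK.
  by rewrite max_r ?subr0 // oppr_le0 ltW.
have pos0 r : 0 <= pos r by rewrite /pos le_max lexx orbT.
have posle r M : `|r| <= M -> pos r <= M.
  move=> h; rewrite /pos ge_max (le_trans _ h) ?ler_norm //=.
  by rewrite (le_trans _ h).
(* The last of the four terms carries no coefficient: three uses of [Plin] leave it to [Prc]. *)
rewrite (_ : f = fun i => -1 * rc (pos (- re (f i))) + ('i * rc (pos (im (f i))) +
   (- 'i * rc (pos (- im (f i))) + rc (pos (re (f i)))))); last first.
  apply/funext => i; rewrite {1}(cplxE (f i)) {1}(posE (re _)) {1}(posE (im _)).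
  by rewrite !rcD !rcN; ring.
do 3 (apply: (Plin _ (fun i => rc _) (fun i => _)); first apply: Prc => // i;
  first by apply: posle; rewrite ?normrN ?re_le_cabs ?im_le_cabs).
by apply: Prc => // i; apply: posle; rewrite re_le_cabs.
Qed.

(** For nonnegative families the limit is a supremum; [asum_ind] carries convergence over to complex
    ones without a Cauchy criterion. *)
Lemma asummable_csum f : asummable f -> csum_to f (csum f).
Proof.
move=> hf; suff [z hz] : csummable f by rewrite (csum_to_csum hz).
apply: (asum_ind (P := @csummable R I)).
  by move=> a a0 af; exists (rc (rsum a)); apply: csum_to_rsum => //; exact: esum_lty hf.
move=> c g h [z hz] [w hw]; exists (c * z + w).
exact: (csum_toD (csum_toZ c hz) hw).
Qed.

Lemma csumD f g : asummable f -> asummable g ->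
  csum (fun i => f i + g i) = csum f + csum g.
Proof. by move=> /asummable_csum hf /asummable_csum hg; exact: (csum_to_csum (csum_toD hf hg)). Qed.

Lemma csumZ c f : asummable f -> csum (fun i => c * f i) = c * csum f.
Proof. by move=> /asummable_csum hf; exact: (csum_to_csum (csum_toZ c hf)). Qed.

Arguments csumZ c {f}.

Lemma csum_conj f : asummable f -> csum (fun i => (f i)^*) = (csum f)^*.
Proof. by move=> /asummable_csum hf; exact: (csum_to_csum (csum_to_conj hf)). Qed.

Lemma csum0 : csum (fun _ : I => 0 : C) = 0.
Proof. exact: (csum_to_csum csum_to0). Qed.

Lemma csum_rc a : (forall i, 0 <= a i) ->
  (\esum_(i in [set: I]) (a i)%:E < +oo)%E ->
  csum (fun i => rc (a i)) = rc (rsum a).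
Proof. by move=> a0 ha; exact: (csum_to_csum (csum_to_rsum a0 ha)). Qed.

Lemma cabs_csum f : asummable f -> ((cabs (csum f))%:E <= asum f)%E.
Proof.
move=> hf; rewrite /asum rsumE // => [|i]; last exact: cabs_ge0.
rewrite lee_fin; apply: (csum_to_le (asummable_csum hf)) => J.
by rewrite (le_trans (sum_cabs _ _)) // sum_le_rsum // => i; apply: cabs_ge0.
Qed.

Lemma csum_single f i0 : (forall i, i != i0 -> f i = 0) -> csum_to f (f i0).
Proof.
move=> f0; apply/csum_toP => e e0; exists [fset i0]%fset => J.
rewrite fsub1set => iJ.
rewrite (big_fsetD1 i0) //= big_seq_cond big1 ?addr0 ?subrr ?cabs0 // => i.
by rewrite !inE andbT => /andP[ii _]; apply: f0.
Qed.

Lemma asummable_single f i0 : (forall i, i != i0 -> f i = 0) -> asummable f.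
Proof.
move=> f0; apply: (@le_lt_trans _ _ (cabs (f i0))%:E); last exact: ltry.
apply: esum_leP => J; case: (boolP (i0 \in J)) => iJ; last first.
  rewrite big_seq big1 ?cabs_ge0 // => i ij; rewrite f0 ?cabs0 //.
  by apply: contraNneq iJ => <-.
rewrite (big_fsetD1 i0) //= big_seq_cond big1 ?addr0 // => i.
by rewrite !inE andbT => /andP[ii _]; rewrite f0 ?cabs0.
Qed.

End one_family.
Arguments csum_toZ {I} c {f z}.
Arguments asummableZ {I} c {f}.
Arguments csumZ {I} c {f}.

Lemma csum_to_reindex (I J : choiceType) (s : I -> J) (t : J -> I) (f : J -> C) z :
  cancel s t -> cancel t s -> csum_to f z -> csum_to (f \o s) z.
Proof.
move=> st ts /csum_toP h; apply/csum_toP => e /h[F hF].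
exists [fset t j | j in F]%fset => K tK.
have := hF [fset s i | i in K]%fset; rewrite big_imfset /=; last first.
  by move=> i j _ _; apply: can_inj st _ _.
apply; apply/fsubsetP => j jF; apply/imfsetP; exists (t j) => //=.
by apply: (fsubsetP tK); apply: in_imfset.
Qed.

(** * Exchange of unordered sums *)

Section fubini.
Variables (I J : choiceType) (F : I -> J -> C).
Hypothesis hF : (\esum_(i in [set: I]) asum (F i) < +oo)%E.

Lemma esum_exchange (a : I -> J -> \bar R) : (forall i j, 0 <= a i j)%E ->
  (\esum_(i in [set: I]) \esum_(j in [set: J]) a i j =
   \esum_(j in [set: J]) \esum_(i in [set: I]) a i j)%E.
Proof.
move=> a0; rewrite !esum_esum //.
rewrite (@reindex_esum R _ _ ([set: J] `*`` (fun=> [set: I]))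
  ([set: I] `*`` (fun=> [set: J])) (fun x => (x.2, x.1))) //.
split=> //; first by move=> [x y] [z w] _ _ /= [-> ->].
by move=> [x y] _; exists (y, x).
Qed.

Lemma fubini_rows i : asummable (F i).
Proof.
rewrite /asummable -ge0_fin_numE; last first.
  by apply: esum_ge0 => j _; rewrite lee_fin cabs_ge0.
rewrite ge0_fin_numE; last by apply: esum_ge0 => j _; rewrite lee_fin cabs_ge0.
apply: le_lt_trans hF; apply: esum_ge; exists [set i]; first by split.
by rewrite fsbig_set1.
Qed.

Lemma fubini_summable : asummable (fun i => csum (F i)).
Proof.
apply: le_lt_trans hF; apply: le_esum => i _; apply: cabs_csum.
exact: fubini_rows.
Qed.

Lemma fubini_swap : (\esum_(j in [set: J]) asum (F ^~ j) < +oo)%E.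
Proof.
rewrite -esum_exchange // => i j; by rewrite lee_fin cabs_ge0.
Qed.

End fubini.

Lemma asum_pair (I J : choiceType) (f : I * J -> C) :
  (\esum_(i in [set: I]) asum (fun j => f (i, j)))%E = asum f.
Proof.
rewrite /asum esum_esum; last by move=> i j _ _; rewrite lee_fin cabs_ge0.
rewrite (_ : _ `*`` _ = setT); last by apply/seteqP; split=> // -[].
by apply: eq_esum => -[].
Qed.

(** The nonnegative case is the exchange of two [esum]s, and [asum_ind] on the index type [I * J]
    extends it. Summability is part of the induction predicate [P], since the linear step relies on
    the additivity of [csum]. *)
Lemma csum_exchange (I J : choiceType) (F : I -> J -> C) :
  (\esum_(i in [set: I]) asum (F i) < +oo)%E ->
  csum (fun i => csum (F i)) = csum (fun j => csum (F ^~ j)).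
Proof.
move=> hF; pose f (p : I * J) := F p.1 p.2.
have hf : asummable f by rewrite /asummable -asum_pair.
have rows g : asummable g -> (\esum_(i in [set: I]) asum (fun j : J => g (i, j)) < +oo)%E.
  by rewrite asum_pair.
pose P (g : I * J -> C) := asummable g /\
  csum (fun i => csum (fun j => g (i, j))) = csum (fun j => csum (fun i => g (i, j))).
suff [] : P f by [].
apply: asum_ind => [a a0 af|c g h [gs ge] [hs he]].
  have ha : asummable (fun p => rc (a p)).
    by apply: asummable_le hf => p; rewrite cabs_rc ger0_norm.
  split=> //.
  have h1 := rows _ ha; have h2 := fubini_swap h1.
  have aE i : asum (fun j => rc (a (i, j))) = (\esum_(j in [set: J]) (a (i, j))%:E)%E.
    by apply: eq_esum => j _; rewrite cabs_rc ger0_norm.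
  have aE' j : asum (fun i => rc (a (i, j))) = (\esum_(i in [set: I]) (a (i, j))%:E)%E.
    by apply: eq_esum => i _; rewrite cabs_rc ger0_norm.
  have f1 i : (\esum_(j in [set: J]) (a (i, j))%:E < +oo)%E.
    by rewrite -aE; exact: (fubini_rows h1).
  have f2 j : (\esum_(i in [set: I]) (a (i, j))%:E < +oo)%E.
    by rewrite -aE'; exact: (fubini_rows h2).
  have e1 i : (\esum_(j in [set: J]) (a (i, j))%:E)%E = (rsum (fun j => a (i, j)))%:E.
    by rewrite rsumE.
  have e2 j : (\esum_(i in [set: I]) (a (i, j))%:E)%E = (rsum (fun i => a (i, j)))%:E.
    by rewrite rsumE.
  have -> : (fun i => csum (fun j => rc (a (i, j)))) = fun i => rc (rsum (fun j => a (i, j))).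
    by apply/funext => i; rewrite csum_rc.
  have -> : (fun j => csum (fun i => rc (a (i, j)))) = fun j => rc (rsum (fun i => a (i, j))).
    by apply/funext => j; rewrite csum_rc.
  rewrite !csum_rc; last first.
  - by under eq_esum do rewrite -e1 -aE.
  - by move=> i; apply: rsum_ge0.
  - by under eq_esum do rewrite -e2 -aE'.
  - by move=> i; apply: rsum_ge0.
  congr (rc (fine _)); under eq_esum do rewrite -e1.
  under [RHS]eq_esum do rewrite -e2.
  by apply: esum_exchange => i j; rewrite lee_fin.
have hs1 := rows _ hs; have gs1 := rows _ gs.
have hs2 := fubini_swap hs1; have gs2 := fubini_swap gs1.
split; first exact: (asummableD (asummableZ c gs) hs).
transitivity (c * csum (fun i => csum (fun j => g (i, j))) + csum (fun i => csum (fun j => h (i, j)))).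
  rewrite -(csumZ c (fubini_summable gs1)).
rewrite -(csumD (asummableZ c (fubini_summable gs1)) (fubini_summable hs1)).
  congr csum; apply/funext => i; have gi := fubini_rows gs1 i; have hi := fubini_rows hs1 i.
  by rewrite (csumD (asummableZ c gi) hi) (csumZ c gi).
rewrite ge he.
rewrite -(csumZ c (fubini_summable gs2)).
rewrite -(csumD (asummableZ c (fubini_summable gs2)) (fubini_summable hs2)).
congr csum; apply/funext => i; have gi := fubini_rows gs2 i; have hi := fubini_rows hs2 i.
by rewrite (csumD (asummableZ c gi) hi) (csumZ c gi).
Qed.

End unordered_sums.

(** * Complex integrals and square integrable functions *)

Section complex_integral.
Variables (R : realType) (X : ptopologicalType) (mu : probability (borel X) R).
Local Notation C := (cplx R).
Implicit Types f g : X -> C.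

Definition cmeas f : Prop :=
  measurable_fun setT (fun x : borel X => re (f x)) /\
  measurable_fun setT (fun x : borel X => im (f x)).

Lemma cmeas_cst c : cmeas (fun _ => c).
Proof. by split; apply: measurable_cst. Qed.

Lemma cmeasD f g : cmeas f -> cmeas g -> cmeas (fun x => f x + g x).
Proof.
move=> [f1 f2] [g1 g2]; split.
  by under eq_fun do rewrite reD; apply: measurable_funD.
by under eq_fun do rewrite imD; apply: measurable_funD.
Qed.

Lemma cmeasM f g : cmeas f -> cmeas g -> cmeas (fun x => f x * g x).
Proof.
move=> [f1 f2] [g1 g2]; split.
  by under eq_fun do rewrite reM; apply: measurable_funB; apply: measurable_funM.
by under eq_fun do rewrite imM; apply: measurable_funD; apply: measurable_funM.
Qed.

Lemma cmeas_conj f : cmeas f -> cmeas (fun x => (f x)^*).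
Proof.
move=> [f1 f2]; split; first by under eq_fun do rewrite re_conj.
by under eq_fun do rewrite im_conj; apply: measurableT_comp.
Qed.

Lemma cmeas_cabs2 f : cmeas f ->
  measurable_fun setT (fun x : borel X => cabs (f x) ^+ 2).
Proof.
move=> [f1 f2]; under eq_fun do rewrite cabs_sqr.
by apply: measurable_funD; apply: measurable_funX.
Qed.

Definition cintegrable f : Prop :=
  mu.-integrable setT (fun x : borel X => (re (f x))%:E) /\
  mu.-integrable setT (fun x : borel X => (im (f x))%:E).

Lemma cintegrable_le f (b : X -> R) : cmeas f ->
  measurable_fun setT (b : borel X -> R) -> (forall x, cabs (f x) <= b x) ->
  (\int[mu]_(x in setT) (b x)%:E < +oo)%E -> cintegrable f.
Proof.
move=> [f1 f2] mb fb bfin.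
have ib : mu.-integrable setT (fun x : borel X => (b x)%:E).
  apply/integrableP; split; first exact/measurable_EFinP.
  rewrite (eq_integral (fun x : borel X => (b x)%:E)) // => x _.
  by rewrite /= ger0_norm // (le_trans (cabs_ge0 _) (fb x)).
have b0 x : `|b x| = b x by rewrite ger0_norm // (le_trans (cabs_ge0 _) (fb x)).
split; apply: le_integrable ib => //; try exact/measurable_EFinP.
  by move=> x _; rewrite /= lee_fin b0 (le_trans (re_le_cabs _)).
by move=> x _; rewrite /= lee_fin b0 (le_trans (im_le_cabs _)).
Qed.

Lemma cintegrableZ c f : cintegrable f -> cintegrable (fun x => c * f x).
Proof.
move=> [f1 f2]; split.
  under eq_fun do rewrite reM EFinB !EFinM.
  by apply: integrableB => //; apply: integrableZl.
under eq_fun do rewrite imM EFinD !EFinM.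
by apply: integrableD => //; apply: integrableZl.
Qed.

Local Notation "'I" := (cintegral mu).

Lemma cintegralD f g : cintegrable f -> cintegrable g ->
  'I (fun x => f x + g x) = 'I f + 'I g.
Proof.
move=> [f1 f2] [g1 g2]; apply: cplxP; rewrite ?reD ?imD /=.
  by under eq_Rintegral do rewrite reD; rewrite RintegralD.
by under eq_Rintegral do rewrite imD; rewrite RintegralD.
Qed.

Lemma cintegralZ c f : cintegrable f -> 'I (fun x => c * f x) = c * 'I f.
Proof.
move=> [f1 f2]; have h r (u : X -> R) :
    mu.-integrable setT (fun x : borel X => (u x)%:E) ->
    mu.-integrable setT (EFin \o (fun x : borel X => r * u x)).
  by move=> hu; apply: (integrableZl measurableT r hu).
have f1c := h (re c) _ f1; have f2c := h (im c) _ f2.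
have f1d := h (im c) _ f1; have f2d := h (re c) _ f2.
apply: cplxP; rewrite ?reM ?imM /=.
  under eq_Rintegral do rewrite reM.
  by rewrite RintegralB // !RintegralZl.
under eq_Rintegral do rewrite imM.
by rewrite RintegralD // !RintegralZl.
Qed.

Lemma cintegral_conj f : cintegrable f -> 'I (fun x => (f x)^*) = ('I f)^*.
Proof.
move=> [f1 f2]; apply: cplxP; rewrite ?re_conj ?im_conj /=.
  by apply: eq_Rintegral => x _; rewrite re_conj.
under eq_Rintegral do rewrite im_conj -mulN1r.
by rewrite RintegralZl // mulN1r.
Qed.

Lemma integral_cst_prob (r : R) : (\int[mu]_(x in setT) r%:E)%E = r%:E.
Proof.
have mu1 := probability_setT mu.
transitivity (r%:E * mu setT)%E; first exact: (integral_cst mu measurableT).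
by rewrite -[RHS]mule1; congr (_ * _)%E.
Qed.

Lemma cintegral_cst c : 'I (fun _ => c) = c.
Proof.
apply: cplxP.
  exact: (congr1 fine (integral_cst_prob (re c))).
exact: (congr1 fine (integral_cst_prob (im c))).
Qed.

Definition L2 f : Prop :=
  cmeas f /\ (\int[mu]_(x in setT) (cabs (f x) ^+ 2)%:E < +oo)%E.

Definition ip f g : C := 'I (fun x => f x * (g x)^*).

(** The squared norm of [L^2(X, mu)]; outside [L2] it may be the default value 0 of [fine]. *)
Definition nsq f : R := fine (\int[mu]_(x in setT) (cabs (f x) ^+ 2)%:E).

Lemma cabs2_linear_le (c z w : C) :
  cabs (c * z + w) ^+ 2 <= 2 * cabs c ^+ 2 * cabs z ^+ 2 + 2 * cabs w ^+ 2.
Proof.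
apply: (@le_trans _ _ ((cabs (c * z) + cabs w) ^+ 2)).
  by rewrite ler_pXn2r ?nnegrE ?addr_ge0 ?cabs_ge0 // cabsD.
by rewrite cabsM; have := sqr_ge0 (cabs c * cabs z - cabs w); nra.
Qed.

Lemma nsqE f : L2 f -> (\int[mu]_(x in setT) (cabs (f x) ^+ 2)%:E)%E = (nsq f)%:E.
Proof.
move=> [mf ff]; rewrite fineK // ge0_fin_numE // integral_ge0 // => x _.
by rewrite lee_fin sqr_ge0.
Qed.

Lemma nsq_ge0 f : 0 <= nsq f.
Proof. by rewrite fine_ge0 // integral_ge0 // => x _; rewrite lee_fin sqr_ge0. Qed.

Lemma L2_linear c f g : L2 f -> L2 g -> L2 (fun x => c * f x + g x).
Proof.
move=> f2 g2; have [mf ff] := f2; have [mg fg] := g2.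
have m : cmeas (fun x => c * f x + g x).
  by apply: cmeasD => //; apply: cmeasM => //; apply: cmeas_cst.
split=> //.
apply: (@le_lt_trans _ _ (\int[mu]_(x in setT)
   ((2 * cabs c ^+ 2)%:E * (cabs (f x) ^+ 2)%:E + 2%:E * (cabs (g x) ^+ 2)%:E))%E).
  apply: ge0_le_integral => //.
  - by move=> x _; rewrite lee_fin sqr_ge0.
  - by apply/measurable_EFinP; apply: cmeas_cabs2.
  - by apply: emeasurable_funD; apply: emeasurable_funM => //;
      apply/measurable_EFinP; apply: cmeas_cabs2.
  - by move=> x _; rewrite lee_fin cabs2_linear_le.
have c0 : 0 <= 2 * cabs c ^+ 2 by rewrite mulr_ge0 ?sqr_ge0.
rewrite ge0_integralD //.
- rewrite !ge0_integralZl //; try by [apply/measurable_EFinP; apply: cmeas_cabs2 |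
    move=> x _; rewrite lee_fin sqr_ge0 | rewrite lee_fin].
  by rewrite !nsqE // -!EFinM -EFinD ltry.
- by move=> x _; rewrite mule_ge0 ?lee_fin ?sqr_ge0.
- by apply: emeasurable_funM => //; apply/measurable_EFinP; apply: cmeas_cabs2.
- by move=> x _; rewrite mule_ge0 ?lee_fin ?sqr_ge0.
- by apply: emeasurable_funM => //; apply/measurable_EFinP; apply: cmeas_cabs2.
Qed.

Lemma L2_integrable f g : L2 f -> L2 g -> cintegrable (fun x => f x * (g x)^*).
Proof.
move=> f2 g2; have [mf ff] := f2; have [mg fg] := g2.
apply: (@cintegrable_le _ (fun x => cabs (f x) ^+ 2 + cabs (g x) ^+ 2)).
- by apply: cmeasM => //; apply: cmeas_conj.
- by apply: measurable_funD; apply: cmeas_cabs2.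
- move=> x; rewrite cabsM cabs_conj.
  have := sqr_ge0 (cabs (f x) - cabs (g x)); have := sqr_ge0 (cabs (f x) + cabs (g x)); nra.
under eq_integral do rewrite EFinD.
rewrite ge0_integralD //.
- by rewrite !nsqE // -EFinD ltry.
- by move=> x _; rewrite lee_fin ?sqr_ge0.
- by apply/measurable_EFinP; apply: cmeas_cabs2.
- by move=> x _; rewrite lee_fin ?sqr_ge0.
- by apply/measurable_EFinP; apply: cmeas_cabs2.
Qed.

Lemma L2_bounded f (M : R) : cmeas f -> (forall x, cabs (f x) <= M) -> L2 f.
Proof.
move=> mf fM; split=> //.
apply: (@le_lt_trans _ _ (\int[mu]_(x in setT) (M ^+ 2)%:E)%E).
  apply: ge0_le_integral => //.
  - by move=> x _; rewrite lee_fin sqr_ge0.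
  - by apply/measurable_EFinP; apply: cmeas_cabs2.
  - move=> x _; rewrite lee_fin ler_pXn2r ?nnegrE ?cabs_ge0 //.
    by rewrite (le_trans (cabs_ge0 _) (fM x)).
by rewrite integral_cst_prob ltry.
Qed.

Lemma L2_cst c : L2 (fun _ => c).
Proof. by apply: (@L2_bounded _ (cabs c)) => //; apply: cmeas_cst. Qed.

Lemma L2_mul_bounded f g (M : R) : cmeas f -> (forall x, cabs (f x) <= M) ->
  L2 g -> L2 (fun x => f x * g x).
Proof.
move=> mf fM g2; have [mg gg] := g2; split; first exact: cmeasM.
apply: (@le_lt_trans _ _ (\int[mu]_(x in setT) ((M ^+ 2)%:E * (cabs (g x) ^+ 2)%:E))%E).
  apply: ge0_le_integral => //.
  - by move=> x _; rewrite lee_fin sqr_ge0.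
  - by apply/measurable_EFinP; apply: cmeas_cabs2; apply: cmeasM.
  - by apply: emeasurable_funM => //; apply/measurable_EFinP; apply: cmeas_cabs2.
  - move=> x _; rewrite lee_fin cabsM exprMn ler_wpM2r ?sqr_ge0 //.
    rewrite ler_pXn2r ?nnegrE ?cabs_ge0 //.
    by rewrite (le_trans (cabs_ge0 _) (fM x)).
rewrite ge0_integralZl //.
- by rewrite nsqE // -EFinM ltry.
- by apply/measurable_EFinP; apply: cmeas_cabs2.
- by move=> x _; rewrite lee_fin sqr_ge0.
- by rewrite lee_fin sqr_ge0.
Qed.

(** [mu] is finite, so the constant 1 lies in [L2] and can be paired with [f]. *)
Lemma L2_cintegrable f : L2 f -> cintegrable f.
Proof.
move=> f2; have := L2_integrable f2 (L2_cst 1).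
by under eq_fun do rewrite conjC1 mulr1.
Qed.

Lemma ip_linear c f g h : L2 f -> L2 g -> L2 h ->
  ip (fun x => c * f x + g x) h = c * ip f h + ip g h.
Proof.
move=> f2 g2 h2; rewrite /ip; under eq_fun do rewrite mulrDl -mulrA.
have fh := L2_integrable f2 h2; have gh := L2_integrable g2 h2.
by rewrite (cintegralD (cintegrableZ c fh) gh) (cintegralZ c fh).
Qed.

Lemma ip_conj f g : L2 f -> L2 g -> ip f g = (ip g f)^*.
Proof.
move=> f2 g2; rewrite /ip -(cintegral_conj (L2_integrable g2 f2)).
by congr 'I; apply/funext => x; rewrite conjM conjCK mulrC.
Qed.

Lemma ip_nsq f : ip f f = rc (nsq f).
Proof.
rewrite /ip; under eq_fun do rewrite mul_conj.
apply: cplxP => //; exact: (congr1 fine (integral_cst_prob 0)).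
Qed.

Lemma ip1 f : ip f (fun _ => 1) = 'I f.
Proof. by rewrite /ip; under eq_fun do rewrite conjC1 mulr1. Qed.

End complex_integral.

(** * Continuous functions on a compact space: measurability and boundedness *)

Section continuous_functions.
Variables (R : realType) (X : ptopologicalType) (mu : probability (borel X) R).
Local Notation C := (cplx R).

Lemma continuous_borel (f : X -> R) : continuous f ->
  measurable_fun setT (f : borel X -> R).
Proof.
move=> cf; apply: (measurability _ (RGenOInfty.measurableE R)).
move=> _ [_ [r ->] <-]; rewrite setTI; apply: sub_sigma_algebra.
by apply: open_comp => //; exact: open_gt.
Qed.

(** [cplx R] has the topology of its [C]-valued norm; real valued 1-Lipschitz functions such as [re]
    and [im] transfer continuity from it to [R]. *)
Lemma lipschitz_continuous (T : topologicalType) (u : C -> R) (phi : T -> C) :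
  (forall z w, `|u z - u w| <= cabs (z - w)) -> continuous phi -> continuous (u \o phi).
Proof.
move=> hu cphi x; apply/cvgrPdist_lt => e e0.
have := cphi x => /(@cvgr_dist_lt _ (cplx R)^o) /(_ (rc e)); rewrite ltr_rc => /(_ e0).
by apply: filterS => y /=; rewrite normcE ltr_rc; exact: le_lt_trans.
Qed.

Lemma continuous_re (T : topologicalType) (phi : T -> C) :
  continuous phi -> continuous (fun x => re (phi x)).
Proof.
move=> cphi; apply: (@lipschitz_continuous T (@re R) phi) => // z w.
by rewrite -reN -reD re_le_cabs.
Qed.

Lemma continuous_im (T : topologicalType) (phi : T -> C) :
  continuous phi -> continuous (fun x => im (phi x)).
Proof.
move=> cphi; apply: (@lipschitz_continuous T (@im R) phi) => // z w.
by rewrite -imN -imD im_le_cabs.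
Qed.

Lemma continuous_cmeas (phi : X -> C) : continuous phi -> cmeas phi.
Proof.
move=> cphi; split; apply: continuous_borel; first exact: continuous_re.
exact: continuous_im.
Qed.

Lemma compact_real_bounded (f : X -> R) : compact [set: X] -> continuous f ->
  exists M, forall x, `|f x| <= M.
Proof.
move=> cX cf; have := @continuous_compact _ _ f setT (continuous_subspaceT cf) cX.
move=> /compact_bounded[M [_ hM]]; exists (M + 1) => x.
by apply: (hM (M + 1)); [rewrite ltrDl | exists x].
Qed.

Lemma continuous_cbounded (phi : X -> C) : compact [set: X] -> continuous phi ->
  exists M, forall x, cabs (phi x) <= M.
Proof.
move=> cX cphi.
have [M hM] := compact_real_bounded cX (continuous_re cphi).
have [N hN] := compact_real_bounded cX (continuous_im cphi).
by exists (M + N) => x; rewrite (le_trans (cabs_le _)) // lerD.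
Qed.

End continuous_functions.

(** * Orthonormal families and Parseval's identity *)

Section pre_hilbert.
Variables (R : realType).
Local Notation C := (cplx R).
Variables (V : lmodType C) (S : V -> Prop) (ip : V -> V -> C).
Local Notation nn u := (re (ip u u)).
Hypothesis S0 : S 0.
Hypothesis Slin : forall c u v, S u -> S v -> S (c *: u + v).
Hypothesis ipL : forall c u v w, S u -> S v -> S w ->
  ip (c *: u + v) w = c * ip u w + ip v w.
Hypothesis ipC : forall u v, S u -> S v -> ip u v = (ip v u)^*.
Hypothesis ip_ge0 : forall u, S u -> 0 <= ip u u.

Lemma subspaceZ c u : S u -> S (c *: u).
Proof. by move=> Su; rewrite -(addr0 (c *: u)); apply: Slin. Qed.

Lemma subspaceB u v : S u -> S v -> S (u - v).
Proof. by move=> Su Sv; rewrite addrC -scaleN1r; apply: Slin. Qed.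

Lemma subspace_sum (I : Type) (r : seq I) (c : I -> C) (e : I -> V) :
  (forall i, S (e i)) -> S (\sum_(i <- r) c i *: e i).
Proof. by move=> Se; elim/big_rec: _ => // i x _ Sx; apply: Slin. Qed.

Lemma ip0l u : S u -> ip 0 u = 0.
Proof.
move=> Su; have := ipL 1 S0 S0 Su; rewrite scale1r addr0 mul1r.
by move=> /eqP; rewrite addrC -subr_eq subrr => /eqP <-.
Qed.

Lemma ipZl c u v : S u -> S v -> ip (c *: u) v = c * ip u v.
Proof.
by move=> Su Sv; have := ipL c Su S0 Sv; rewrite addr0 ip0l // addr0.
Qed.

Lemma ipBl u v w : S u -> S v -> S w -> ip (u - v) w = ip u w - ip v w.
Proof.
by move=> Su Sv Sw; rewrite addrC -scaleN1r ipL // mulN1r addrC.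
Qed.

Lemma ip_suml (I : Type) (r : seq I) (c : I -> C) (e : I -> V) w :
  (forall i, S (e i)) -> S w ->
  ip (\sum_(i <- r) c i *: e i) w = \sum_(i <- r) c i * ip (e i) w.
Proof.
move=> Se Sw; elim: r => [|i r IH]; first by rewrite !big_nil ip0l.
by rewrite !big_cons ipL ?IH //; apply: subspace_sum.
Qed.

Lemma nnE u : S u -> ip u u = rc (nn u).
Proof. by move=> Su; apply: ge0_rc; apply: ip_ge0. Qed.

Lemma nn_ge0 u : S u -> 0 <= nn u.
Proof. by move=> Su; rewrite -rc_ge0 -nnE ?ip_ge0. Qed.

Lemma nn_lin c u v : S u -> S v ->
  nn (c *: u + v) = cabs c ^+ 2 * nn u + 2 * re (c * ip u v) + nn v.
Proof.
move=> Su Sv; have Sw := Slin c Su Sv.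
rewrite ipL // (ipC Su Sw) (ipC Sv Sw) !ipL // !conjD !conjM -!(ipC _ _) //.
rewrite [ip v u]ipC // (nnE Su) (nnE Sv) !(reD, reM, imD, imM, re_conj, im_conj, re_rc, im_rc) cabs_sqr.
ring.
Qed.

Lemma nnB u v : S u -> S v -> nn (u - v) = nn u - 2 * re (ip u v) + nn v.
Proof.
move=> Su Sv; rewrite addrC -scaleN1r nn_lin // cabsN cabs1 mulN1r reN [ip v u]ipC // re_conj.
ring.
Qed.

Lemma nnD_le u v : S u -> S v -> nn (u + v) <= 2 * nn u + 2 * nn v.
Proof.
move=> Su Sv; have := nn_ge0 (subspaceB Su Sv); rewrite nnB //.
have := nn_lin 1 Su Sv; rewrite scale1r mul1r cabs1 => ->; lra.
Qed.

(** The squared norm of [- t <u,v>^* u + v] is a quadratic in the real number [t], evaluated at its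
    minimum [(nn u)^-1]. The form is only semidefinite: when [nn u = 0] the quadratic is affine, and
    a nonzero [a] would make it equal to -1 at [(nn v + 1) / (2 a)]. *)
Lemma cauchy_schwarz u v : S u -> S v -> cabs (ip u v) ^+ 2 <= nn u * nn v.
Proof.
move=> Su Sv; set a := _ ^+ 2; have A0 := nn_ge0 Su; have B0 := nn_ge0 Sv.
have a0 : 0 <= a by exact: sqr_ge0.
have key t : 0 <= t ^+ 2 * a * nn u - 2 * t * a + nn v.
  have := nn_ge0 (Slin (- rc t * (ip u v)^*) Su Sv); rewrite nn_lin //.
  rewrite cabsM cabsN cabs_rc cabs_conj exprMn real_normK ?num_real //.
  rewrite -[_ * _ * ip u v]mulrA [_^* * _]mulrC mul_conj -/a mulNr reN -rcM re_rc.
  by move=> h; apply: le_trans h _; rewrite le_eqVlt; apply/orP; left; apply/eqP; ring.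
case: (eqVneq (nn u) 0) => [u0|u0].
  rewrite u0 mul0r leNgt; apply/negP => apos.
  have := key ((nn v + 1) / (2 * a)); rewrite u0 mulr0 add0r.
  have -> : 2 * ((nn v + 1) / (2 * a)) * a = nn v + 1 by field; rewrite gt_eqF.
  by rewrite opprD addrAC addNr add0r oppr_ge0 leNgt ltr01.
have := key (nn u)^-1.
have -> : (nn u)^-1 ^+ 2 * a * nn u - 2 * (nn u)^-1 * a + nn v = nn v - a / nn u by field.
by rewrite subr_ge0 ler_pdivrMr ?lt_def ?u0 // mulrC.
Qed.

Section orthonormal.
Variables (I : choiceType) (e : I -> V).
Hypothesis Se : forall i, S (e i).
Hypothesis eON : forall i j, ip (e i) (e j) = (i == j)%:R.

Lemma ip_comb_e (F : {fset I}) (c : I -> C) j :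
  ip (\sum_(i <- F) c i *: e i) (e j) = if j \in F then c j else 0.
Proof.
rewrite ip_suml //; case: ifPn => jF; last first.
  rewrite big_seq big1 // => i iF; rewrite eON; case: eqP => [ij|]; last by rewrite mulr0.
  by rewrite -ij iF in jF.
rewrite (big_fsetD1 j) //= eON eqxx mulr1 big_seq big1 ?addr0 // => i.
by rewrite !inE eON => /andP[/negbTE -> _]; rewrite mulr0.
Qed.

Lemma ip_comb_sub (F K : {fset I}) (c : I -> C) : (F `<=` K)%fset ->
  ip (\sum_(i <- F) c i *: e i) (\sum_(i <- K) c i *: e i) =
  rc (\sum_(i <- F) cabs (c i) ^+ 2).
Proof.
move=> FK; have SK := subspace_sum K c Se; rewrite ip_suml // rc_sum [LHS]big_seq [RHS]big_seq.
apply: eq_bigr => i iF; rewrite ipC // ip_comb_e (fsubsetP FK i iF).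
by rewrite mul_conj.
Qed.

Lemma nn_comb (F : {fset I}) (c : I -> C) :
  nn (\sum_(i <- F) c i *: e i) = \sum_(i <- F) cabs (c i) ^+ 2.
Proof. by rewrite ip_comb_sub. Qed.

Lemma nn_comb_diff (F K : {fset I}) (c : I -> C) : (F `<=` K)%fset ->
  nn (\sum_(i <- K) c i *: e i - \sum_(i <- F) c i *: e i) =
  \sum_(i <- K) cabs (c i) ^+ 2 - \sum_(i <- F) cabs (c i) ^+ 2.
Proof.
move=> FK; have SK := subspace_sum K c Se; have SF := subspace_sum F c Se.
rewrite nnB // !nn_comb [ip _ _]ipC // ip_comb_sub // re_conj re_rc; ring.
Qed.

Lemma nn_remainder (F : {fset I}) u : S u ->
  nn (u - \sum_(i <- F) ip u (e i) *: e i) =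
  nn u - \sum_(i <- F) cabs (ip u (e i)) ^+ 2.
Proof.
move=> Su; have SF := subspace_sum F (fun i => ip u (e i)) Se.
rewrite nnB // nn_comb [ip u (\sum_(_ <- _) _)]ipC // re_conj ip_suml //.
have -> : \sum_(i <- F) ip u (e i) * ip (e i) u = rc (\sum_(i <- F) cabs (ip u (e i)) ^+ 2).
  by rewrite rc_sum; apply: eq_bigr => i _; rewrite [ip (e i) u]ipC // mul_conj.
by rewrite re_rc; ring.
Qed.

Lemma bessel (F : {fset I}) u : S u -> \sum_(i <- F) cabs (ip u (e i)) ^+ 2 <= nn u.
Proof.
move=> Su; rewrite -subr_ge0 -nn_remainder // nn_ge0 //.
by apply: subspaceB => //; apply: subspace_sum.
Qed.

Lemma bessel_esum u : S u ->
  (\esum_(i in [set: I]) (cabs (ip u (e i)) ^+ 2)%:E < +oo)%E.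
Proof.
move=> Su; apply: (@le_lt_trans _ _ (nn u)%:E); last exact: ltry.
by apply: esum_leP => J; apply: bessel.
Qed.

(** A bound by the product of the norms, not by a sum of their squares, is essential for the later
    sum over [G]: there one of the two vectors has norm 1 in every fibre. *)
Lemma bessel_product (F : {fset I}) u v : S u -> S v ->
  \sum_(i <- F) cabs (ip u (e i) * ip (e i) v) <= Num.sqrt (nn u) * Num.sqrt (nn v).
Proof.
move=> Su Sv.
(* Multiplying the coefficients by phases turns the sum of moduli into one
   inner product. *)
pose z i := ip u (e i) * ip (e i) v.
pose th i := (z i)^* * rc (cabs (z i))^-1.
have thz i : th i * z i = rc (cabs (z i)).
  rewrite /th mulrAC [_^* * _]mulrC mul_conj -rcM; congr rc.
  have [->|z0] := eqVneq (cabs (z i)) 0; first by rewrite expr0n mul0r.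
  by rewrite expr2 -mulrA divff ?mulr1.
(* Only an inequality, since the phase [th i] is 0 where [z i] vanishes. *)
have th1 i : cabs (th i) ^+ 2 <= 1.
  rewrite cabsM cabs_conj cabs_rc normfV (ger0_norm (cabs_ge0 _)).
  have [->|z0] := eqVneq (cabs (z i)) 0; first by rewrite mul0r expr0n.
  by rewrite divff ?expr1n.
set w := \sum_(i <- F) (th i * ip u (e i)) *: e i.
have Sw : S w by exact: subspace_sum.
have wv : ip w v = rc (\sum_(i <- F) cabs (z i)).
  by rewrite ip_suml // rc_sum; apply: eq_bigr => i _; rewrite -mulrA thz.
have z0 : 0 <= \sum_(i <- F) cabs (z i) by apply: sumr_ge0 => i _; apply: cabs_ge0.
rewrite -(@ler_pXn2r _ 2) ?nnegrE ?mulr_ge0 ?sqrtr_ge0 //.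
rewrite exprMn !sqr_sqrtr ?nn_ge0 //.
have := cauchy_schwarz Sw Sv; rewrite wv cabs_rc ger0_norm // => h.
apply: le_trans h _; rewrite ler_wpM2r ?nn_ge0 // nn_comb.
apply: le_trans (bessel F Su); apply: ler_sum => i _.
by rewrite cabsM exprMn ler_piMl ?sqr_ge0.
Qed.

Lemma asummable_product u v : S u -> S v ->
  asummable (fun i => ip u (e i) * ip (e i) v).
Proof.
move=> Su Sv; apply: le_lt_trans (ltry (Num.sqrt (nn u) * Num.sqrt (nn v))).
by apply: esum_leP => J; apply: bessel_product.
Qed.

Section parseval.
(** Squared distances [4^-m] mean distances [2^-m], a summable rate; this is what makes almost
    everywhere convergence available when the hypothesis is verified for [ell2]. *)
Hypothesis complete : forall u : nat -> V, (forall n, S (u n)) ->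
  (forall m n, (m <= n)%N -> nn (u n - u m) <= 4^-1 ^+ m) ->
  exists2 v, S v & forall m, nn (v - u m) <= 4^-1 ^+ m.
Hypothesis emax : forall v, S v -> (forall i, ip v (e i) = 0) -> ip v v = 0.

Lemma geometric_squeeze (x K : R) : (forall n, x <= K * 4^-1 ^+ n) -> x <= 0.
Proof.
move=> h; rewrite leNgt; apply/negP => x0.
have K0 : 0 <= K by have := h 0%N; rewrite expr0 mulr1; apply/le_trans/ltW.
have := archi_boundP (divr_ge0 K0 (ltW x0)); set n := Num.bound _ => hn.
have n4 : (n%:R : R) <= 4 ^+ n by rewrite -natrX ler_nat ltnW // ltn_expl.
have := h n; rewrite exprVn ler_pdivlMr ?exprn_gt0 //.
apply/negP; rewrite -ltNge mulrC -ltr_pdivrMr //; exact: lt_le_trans n4.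
Qed.

(** Bessel gives one inequality. For the other, finite partial expansions of [u] converge to some
    [w] with the same coefficients as [u]; then [u - w] is orthogonal to the whole family, hence
    null by maximality, and the expansions approach [u] itself. *)
Lemma parseval u : S u -> nn u = rsum (fun i => cabs (ip u (e i)) ^+ 2).
Proof.
move=> Su; pose c i := ip u (e i); pose a i := cabs (c i) ^+ 2.
have a0 i : 0 <= a i by exact: sqr_ge0.
have afin : (\esum_(i in [set: I]) (a i)%:E < +oo)%E by exact: bessel_esum.
apply/eqP; rewrite eq_le; apply/andP; split; last first.
  by rewrite -lee_fin -rsumE //; apply: esum_leP => J; apply: bessel.
set s := rsum _.
have q0 n : 0 < 4^-1 ^+ n :> R by rewrite exprn_gt0 // invr_gt0.
have /choice[F hF] n : exists F : {fset I}, s - 4^-1 ^+ n < \sum_(i <- F) a i.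
  exact: rsum_approx.
(* Cumulative unions make the finite sets nested, so that the difference of two expansions is a tail
   of the sum of squares. *)
pose K := fix K n := if n is m.+1 then (K m `|` F m.+1)%fset else F 0%N.
have FK n : (F n `<=` K n)%fset by case: n => //= n; apply: fsubsetUr.
have Kmono m n : (m <= n)%N -> (K m `<=` K n)%fset.
  elim: n => [|n IH]; first by rewrite leqn0 => /eqP ->.
  rewrite leq_eqVlt => /orP[/eqP -> //|/IH h].
  by apply: fsubset_trans h _; apply: fsubsetUl.
have sum_mono (A B : {fset I}) : (A `<=` B)%fset -> \sum_(i <- A) a i <= \sum_(i <- B) a i.
  move=> AB; rewrite (big_fsetID _ (mem A) B) /=.
  rewrite (_ : [fset x in B | x \in mem A]%fset = A); last first.
    apply/fsetP => x; rewrite !inE /= andbC; case: (boolP (x \in A)) => //= xA.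
    exact: (fsubsetP AB).
  by rewrite lerDl sumr_ge0.
have hK n : s - \sum_(i <- K n) a i <= 4^-1 ^+ n.
  by have := hF n; have := sum_mono _ _ (FK n); lra.
have Ks n : \sum_(i <- K n) a i <= s by exact: sum_le_rsum.
pose v n := \sum_(i <- K n) c i *: e i.
have Sv n : S (v n) by exact: subspace_sum.
have [|w Sw hw] := complete Sv.
  move=> m n mn; rewrite nn_comb_diff ?Kmono //.
  by have := hK m; have := Ks n; rewrite /a; lra.
have wc i : ip w (e i) = c i.
  apply/eqP; rewrite -subr_eq0; apply/eqP/cabs_eq0/eqP; rewrite -sqrf_eq0.
  (* The constant 4 is 2 + 2: [cabs2_linear_le] applied to two differences, each with square at most
     [4^-n]. *)
  apply/eqP/le_anti; rewrite sqr_ge0 andbT; apply: (@geometric_squeeze _ 4) => n.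
  have h1 : cabs (ip w (e i) - ip (v n) (e i)) ^+ 2 <= 4^-1 ^+ n.
    rewrite -ipBl //; apply: le_trans (cauchy_schwarz (subspaceB Sw (Sv n)) (Se i)) _.
    by rewrite eON eqxx mulr1 hw.
  (* An index missing from [K n] contributes its full square [a i], which is at most what the sum
     over [K n] still lacks. *)
  have h2 : cabs (ip (v n) (e i) - c i) ^+ 2 <= 4^-1 ^+ n.
    rewrite ip_comb_e; case: ifPn => iK; first by rewrite subrr cabs0 expr0n /= ltW.
    rewrite sub0r cabsN -/(a i); have := hK n.
    have : \sum_(j <- (i |` K n)%fset) a j <= s by exact: sum_le_rsum.
    by rewrite big_fsetU1 //=; lra.
  have -> : ip w (e i) - c i = 1 * (ip w (e i) - ip (v n) (e i)) + (ip (v n) (e i) - c i).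
    by ring.
  by apply: le_trans (cabs2_linear_le _ _ _) _; rewrite cabs1; lra.
have uw : ip (u - w) (u - w) = 0.
  by apply: emax => [|i]; rewrite ?ipBl ?wc ?subrr //; exact: subspaceB.
have Suw := subspaceB Su Sw.
(* [u - w] has norm 0 but need not be 0, so its inner products are killed by Cauchy-Schwarz. *)
have uw0 x : S x -> ip (u - w) x = 0.
  move=> Sx; apply/cabs_eq0/eqP; rewrite -sqrf_eq0; apply/eqP/le_anti.
  by rewrite sqr_ge0 andbT (le_trans (cauchy_schwarz Suw Sx)) // uw mul0r.
rewrite -subr_le0; apply: (@geometric_squeeze _ 1) => n; rewrite mul1r.
have Swv := subspaceB Sw (Sv n).
have : nn (u - v n) <= 4^-1 ^+ n.
  have -> : u - v n = 1 *: (u - w) + (w - v n) by rewrite scale1r addrA subrK.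
  by rewrite nn_lin // uw uw0 // mulr0 !mulr0 !add0r.
by rewrite nn_remainder //; have := Ks n; rewrite /a /c; lra.
Qed.

(** Polarisation: expanding Parseval's identity for [c u + v] isolates the real part of [c <u,v>].
    The choices [c = 1] and [c = 'i] give the real and the imaginary part. *)
Lemma parseval_product u v : S u -> S v ->
  csum (fun i => ip u (e i) * ip (e i) v) = ip u v.
Proof.
move=> Su Sv.
pose x i := ip u (e i); pose y i := ip v (e i).
have yE i : ip (e i) v = (y i)^* by rewrite ipC.
have hz : asummable (fun i => x i * (y i)^*).
  by have := asummable_product Su Sv; under [X in asummable X -> _]eq_fun do rewrite yE.
under eq_fun do rewrite yE -/(x _).
have sq0 (z : I -> C) i : 0 <= cabs (z i) ^+ 2 by exact: sqr_ge0.
have xfin := bessel_esum Su; have yfin := bessel_esum Sv.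
have key c : re (c * csum (fun i => x i * (y i)^*)) = re (c * ip u v).
  have Sw := Slin c Su Sv.
  have := nn_lin c Su Sv; rewrite parseval // (parseval Su) (parseval Sv).
  have wE i : ip (c *: u + v) (e i) = c * x i + y i by rewrite ipL.
  have cx : asummable (fun i => rc (cabs c ^+ 2) * rc (cabs (x i) ^+ 2)).
    apply: asummableZ; apply: asummable_le xfin => i.
    by rewrite cabs_rc ger0_norm.
  have cy : asummable (fun i => rc (cabs (y i) ^+ 2)).
    by apply: asummable_le yfin => i; rewrite cabs_rc ger0_norm.
  have cz : asummable (fun i => c * (x i * (y i)^*)) by exact: asummableZ.
  have czc := asummable_conj cz.
  have E : rc (rsum (fun i => cabs (ip (c *: u + v) (e i)) ^+ 2)) =
     rc (cabs c ^+ 2) * rc (rsum (fun i => cabs (x i) ^+ 2)) +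
      (c * csum (fun i => x i * (y i)^*) + (c * csum (fun i => x i * (y i)^*))^*) +
      rc (rsum (fun i => cabs (y i) ^+ 2)).
    rewrite -csum_rc; [|by move=> i; exact: sqr_ge0|exact: bessel_esum].
    rewrite -(csum_rc (a := fun i => cabs (x i) ^+ 2) (sq0 x) xfin).
    rewrite -(csum_rc (a := fun i => cabs (y i) ^+ 2) (sq0 y) yfin).
    rewrite -(csumZ c hz) -(csum_conj cz) -csumZ; last first.
      by apply: asummable_le xfin => i; rewrite cabs_rc ger0_norm.
    rewrite -(csumD cz czc) -(csumD cx (asummableD cz czc)).
    rewrite -(csumD (asummableD cx (asummableD cz czc)) cy).
    congr csum; apply/funext => i; rewrite wE -!mul_conj conjD !conjM conjCK.
    by ring.
  have := congr1 (@re R) E; rewrite !reD reM re_conj !re_rc im_rc mulr0 subr0.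
  move=> -> h; move: h; rewrite /x /y; set A := _ * rsum _; set B := rsum _.
  lra.
apply: cplxP; first by have := key 1; rewrite !mul1r.
have := key 'i; rewrite !reM re_i im_i.
by rewrite !mul0r !mul1r !sub0r => /oppr_inj.
Qed.

End parseval.
End orthonormal.
End pre_hilbert.

(** * Almost everywhere convergence *)

Section rapid_convergence.
Variables (d : measure_display) (T : measurableType d) (R : realType).
Variable mu : probability T R.

(* A sequence whose increments have squared L2 norms at most [4^-n] has
   increments of L1 norm at most [2^-n], hence converges almost everywhere. *)
Lemma ae_cvg_of_rapid (F : nat -> T -> R) :
  (forall n, measurable_fun setT (F n)) ->
  (forall n, (\int[mu]_(x in setT) ((F n.+1 x - F n x) ^+ 2)%:E <= (4^-1 ^+ n)%:E)%E) ->
  exists2 f : T -> R, measurable_fun setT f &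
    {ae mu, forall x, (F n x @[n --> \oo] --> f x)}.
Proof.
move=> mF hF.
(* The upper limit is measurable whether or not the sequence converges, and is the limit wherever it
   does. *)
exists (fun x => fine (limn_esup (fun n => (F n x)%:E))).
  apply: measurableT_comp => //; apply: measurable_fun_limn_esup => n.
  exact/measurable_EFinP.
have mD n : measurable_fun setT (fun x => F n.+1 x - F n x) by exact: measurable_funB.
pose g n (x : T) : \bar R := `|F n.+1 x - F n x|%:E.
have mg n : measurable_fun setT (g n).
  by apply/measurable_EFinP; apply: measurableT_comp.
have g0 n x : (0 <= g n x)%E by rewrite lee_fin.
(* This is [2^-n], written in the shape of [epsilon_trick0] with constant 2. *)
have gint n : (\int[mu]_(x in setT) g n x <= (2 / (2 ^ n.+1)%:R)%:E)%E.
  have t0 : 0 < 2 ^+ n :> R by rewrite exprn_gt0.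
  (* With [t = 2^n], the inequality [y <= t y^2 / 2 + 1 / (2 t)] is integrated; this weight makes
     both terms at most [2^-n / 2]. *)
  apply: (@le_trans _ _ (\int[mu]_(x in setT)
     ((2 ^+ n / 2)%:E * ((F n.+1 x - F n x) ^+ 2)%:E + ((2 ^+ n)^-1 / 2)%:E))%E).
    apply: ge0_le_integral => //.
      apply: emeasurable_funD => //; apply: emeasurable_funM => //.
      by apply/measurable_EFinP; apply: measurable_funX.
    move=> x _; rewrite /g lee_fin -(real_normK (num_real (F n.+1 x - F n x))).
    set y := `|_|; have := sqr_ge0 (2 ^+ n * y - 1); set t := 2 ^+ n.
    move=> h; have -> : t / 2 * y ^+ 2 + t^-1 / 2 = ((t * y - 1) ^+ 2 + 2 * t * y) / (2 * t).
      by field; rewrite gt_eqF.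
    rewrite ler_pdivlMr ?mulr_gt0 //; nra.
  rewrite ge0_integralD //; last first.
  - by apply: emeasurable_funM => //; apply/measurable_EFinP; apply: measurable_funX.
  - by move=> x _; rewrite -EFinM lee_fin mulr_ge0 ?sqr_ge0 // divr_ge0 // ltW.
  rewrite ge0_integralZl //; last first.
  - by move=> x _; rewrite lee_fin sqr_ge0.
  - by apply/measurable_EFinP; apply: measurable_funX.
  have -> : (\int[mu]_(x in setT) ((2 ^+ n)^-1 / 2)%:E = ((2 ^+ n)^-1 / 2)%:E)%E.
    have mu1 := probability_setT mu.
    transitivity (((2 ^+ n)^-1 / 2)%:E * mu setT)%E; first exact: (integral_cst mu measurableT).
    by rewrite mu1 mule1.
  apply: (@le_trans _ _ ((2 ^+ n / 2)%:E * (4^-1 ^+ n)%:E + ((2 ^+ n)^-1 / 2)%:E)%E).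
    by rewrite leeD2r // lee_wpmul2l // lee_fin divr_ge0 // ltW.
  rewrite -EFinM -EFinD lee_fin le_eqVlt; apply/orP; left; apply/eqP.
  rewrite natrX exprS (_ : 4 = 2 ^+ 2 :> R); last by rewrite -natrX.
  by rewrite exprVn -exprM mulnC exprM; field; rewrite gt_eqF.
have gs : (\int[mu]_(x in setT) (\sum_(n <oo) g n x) < +oo)%E.
  rewrite integral_nneseries //; apply: (@le_lt_trans _ _ 2%:E); last exact: ltry.
  apply: le_trans (@epsilon_trick0 R 2 predT _); last by [].
  by apply: lee_nneseries => [n _ _|n _]; [apply: integral_ge0 | exact: gint].
have gs0 x : (0 <= \sum_(n <oo) g n x)%E by exact: nneseries_ge0.
have ig : mu.-integrable setT (fun x => \sum_(n <oo) g n x)%E.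
  apply/integrableP; split.
    by apply: ge0_emeasurable_sum.
  by under eq_integral do rewrite gee0_abs //.
apply: filterS (integrable_ae measurableT ig) => x /(_ I) xfin.
suff : cvgn (fun n => F n x).
  move=> /cvg_ex[l hl].
  have /cvg_limn_einf_sup[_ ->] : (F n x)%:E @[n --> \oo] --> l%:E.
    by apply: cvg_EFin; [exact: nearW | exact: hl].
  exact: hl.
suff : cvgn (series (telescope (fun n => F n x))).
  move=> /cvg_ex[l hl]; have -> : (fun n => F n x) = fun n => F 0%N x + series (telescope (fun n => F n x)) n.
    by apply/funext => n; apply: eq_sum_telescope.
  by apply/cvg_ex; exists (F 0%N x + l); apply: cvgD hl; exact: cvg_cst.
apply: normed_cvg; apply: nondecreasing_is_cvgn.
  by apply: nondecreasing_series => n _ _; exact: normr_ge0.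
exists (fine (\sum_(n <oo) g n x)%E) => _ [n _ <-].
rewrite -lee_fin fineK // /series /= -sumEFin.
exact: nneseries_lim_ge.
Qed.

Lemma cvg_sum_seq (I : eqType) (s : seq I) (f : nat -> I -> R) (l : I -> R) :
  (forall i, i \in s -> f n i @[n --> \oo] --> l i) ->
  \sum_(i <- s) f n i @[n --> \oo] --> \sum_(i <- s) l i.
Proof.
elim: s => [_|i s IH h].
  by rewrite big_nil; under eq_cvg do rewrite big_nil; exact: cvg_cst.
rewrite big_cons; under eq_cvg do rewrite big_cons.
apply: cvgD; first by apply: h; rewrite mem_head.
by apply: IH => j js; apply: h; rewrite in_cons js orbT.
Qed.

Lemma ae_imply2 (P Q S : T -> Prop) : {ae mu, forall x, P x} ->
  {ae mu, forall x, Q x} -> (forall x, P x -> Q x -> S x) -> {ae mu, forall x, S x}.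
Proof. by move=> hP hQ hS; apply: filterS2 hP hQ. Qed.

Lemma ae_all_seq (I : eqType) (s : seq I) (P : I -> T -> Prop) :
  (forall i, {ae mu, forall x, P i x}) ->
  {ae mu, forall x, forall i, i \in s -> P i x}.
Proof.
move=> hP; elim: s => [|i s IH]; first by apply: aeW.
apply: filterS2 (hP i) IH => x h1 h2 j; rewrite in_cons => /orP[/eqP ->|] //.
exact: h2.
Qed.

Lemma fatou_le (f : nat -> T -> R) (g : T -> R) (c : R) :
  (forall n, measurable_fun setT (f n)) -> measurable_fun setT g ->
  (forall n x, 0 <= f n x) -> (forall x, 0 <= g x) ->
  {ae mu, forall x, (f n x @[n --> \oo] --> g x)} ->
  (forall n, (\int[mu]_(x in setT) (f n x)%:E <= c%:E)%E) ->
  (\int[mu]_(x in setT) (g x)%:E <= c%:E)%E.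
Proof.
move=> mf mg f0 g0 fg fc.
have mEf n : measurable_fun setT (fun x => (f n x)%:E) by exact/measurable_EFinP.
have ml : measurable_fun setT (fun x => limn_einf (fun n => (f n x)%:E)).
  by apply: measurableT_comp => //; apply: measurable_fun_limn_esup => n; apply: measurableT_comp.
have l0 x : (0 <= limn_einf (fun n => (f n x)%:E))%E.
  rewrite limn_einf_lim; apply: lime_ge; first exact: is_cvg_einfs.
  apply: nearW => n; apply: le_ereal_inf_tmp => _ [k _ <-].
  by rewrite lee_fin.
apply: (@le_trans _ _ (\int[mu]_(x in setT) limn_einf (fun n => (f n x)%:E))%E).
  apply: ae_ge0_le_integral => //.
  - by move=> x _; rewrite lee_fin.
  - exact/measurable_EFinP.
  apply: filterS fg => x hx _.
  have /cvg_limn_einf_sup[-> _] : (f n x)%:E @[n --> \oo] --> (g x)%:E.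
    by apply: cvg_EFin; [exact: nearW | exact: hx].
  by [].
apply: le_trans (fatou mu measurableT mEf _) _.
  by move=> n x _; rewrite lee_fin.
rewrite limn_einf_lim; apply: lime_le; first exact: is_cvg_einfs.
apply: nearW => n; apply: le_trans (fc n).
by apply: ereal_inf_lbound; exists n => /=.
Qed.

End rapid_convergence.

(** * The space l^2(G, L^2(X, mu)) *)

Section L2_inner_product.
Variables (R : realType) (X : ptopologicalType) (mu : probability (borel X) R).
Local Notation C := (cplx R).
Implicit Types f g : X -> C.
Local Notation V := (X -> (cplx R)^o).

(** Restates [ip_linear] with the module operations of [X -> (cplx R)^o], so that the results on
    semidefinite forms apply to [L2]. *)
Lemma ip_lin (c : C) (u v w : V) : L2 mu u -> L2 mu v -> L2 mu w ->
  ip mu (c *: u + v) w = c * ip mu u w + ip mu v w.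
Proof. exact: ip_linear. Qed.

Lemma L2_lin (c : C) (u v : V) : L2 mu u -> L2 mu v -> L2 mu (c *: u + v).
Proof. exact: L2_linear. Qed.

Lemma ip_self_ge0 (u : V) : L2 mu u -> 0 <= ip mu u u.
Proof. by move=> _; rewrite ip_nsq rc_ge0 nsq_ge0. Qed.

Lemma ip_cauchy_schwarz f g : L2 mu f -> L2 mu g ->
  cabs (ip mu f g) ^+ 2 <= nsq mu f * nsq mu g.
Proof.
move=> f2 g2.
have := @cauchy_schwarz R V (L2 mu) (ip mu) (@L2_lin) (@ip_lin)
  (@ip_conj R X mu) (@ip_self_ge0) f g f2 g2.
by rewrite !ip_nsq.
Qed.

Lemma ip_cauchy_schwarz_sqrt f g : L2 mu f -> L2 mu g ->
  cabs (ip mu f g) <= Num.sqrt (nsq mu f) * Num.sqrt (nsq mu g).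
Proof.
move=> f2 g2; rewrite -(@ler_pXn2r _ 2) ?nnegrE ?cabs_ge0 ?mulr_ge0 ?sqrtr_ge0 //.
rewrite exprMn (sqr_sqrtr (nsq_ge0 mu f)) (sqr_sqrtr (nsq_ge0 mu g)).
exact: ip_cauchy_schwarz.
Qed.

Lemma nsq_linear (c : C) f g : L2 mu f -> L2 mu g ->
  nsq mu (fun x => c * f x + g x) =
  cabs c ^+ 2 * nsq mu f + 2 * re (c * ip mu f g) + nsq mu g.
Proof.
move=> f2 g2.
have := @nn_lin R V (L2 mu) (ip mu) (@L2_lin) (@ip_lin)
  (@ip_conj R X mu) (@ip_self_ge0) c f g f2 g2.
by rewrite !ip_nsq.
Qed.

(** Parallelogram argument: the squared norms of [c f + g] and [- c f + g] have opposite cross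
    terms, and the second is nonnegative. *)
Lemma nsq_linear_le (c : C) f g : L2 mu f -> L2 mu g ->
  nsq mu (fun x => c * f x + g x) <= 2 * cabs c ^+ 2 * nsq mu f + 2 * nsq mu g.
Proof.
move=> f2 g2; have := nsq_ge0 mu (fun x => - c * f x + g x).
by rewrite !nsq_linear // cabsN mulNr reN; lra.
Qed.

Lemma nsqZ (c : C) f : L2 mu f -> nsq mu (fun x => c * f x) = cabs c ^+ 2 * nsq mu f.
Proof.
move=> f2; have := nsq_linear c f2 (L2_cst mu 0).
have -> : nsq mu (fun=> 0) = 0.
  by apply: rc_inj; rewrite -ip_nsq /ip; under eq_fun do rewrite mul0r; rewrite cintegral_cst.
have -> : ip mu f (fun=> 0) = 0.
  by rewrite /ip; under eq_fun do rewrite conjC0 mulr0; rewrite cintegral_cst.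
by under eq_fun do rewrite addr0; rewrite mulr0 /= mulr0 !addr0.
Qed.

Lemma nsq_eq f g : (forall x, cabs (f x) = cabs (g x)) -> nsq mu f = nsq mu g.
Proof. by move=> fg; rewrite /nsq; congr fine; apply: eq_integral => x _; rewrite fg. Qed.

Lemma nsq_cst1 : nsq mu (fun=> 1) = 1.
Proof. by apply: rc_inj; rewrite -ip_nsq ip1 cintegral_cst. Qed.

End L2_inner_product.

(** * The inner product of [ell2] and its completeness *)

Section ell2_space.
Variables (R : realType) (G : groupType) (X : ptopologicalType).
Variable mu : probability (borel X) R.
Local Notation C := (cplx R).
Local Notation V := (G -> X -> (cplx R)^o).
Local Notation dot := (dot mu).
Implicit Types (u v w : vec R G X).

Lemma ell2P v : ell2 mu v <-> (forall h, L2 mu (v h)) /\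
  (\esum_(h in [set: G]) (nsq mu (v h))%:E < +oo)%E.
Proof.
have E h : (\int[mu]_(x in setT) (re (`|v h x| ^+ 2))%:E =
    \int[mu]_(x in setT) (cabs (v h x) ^+ 2)%:E)%E.
  by apply: eq_integral => x _; rewrite re_norm_sqr.
have i0 h : (0 <= \int[mu]_(x in setT) (cabs (v h x) ^+ 2)%:E)%E.
  by apply: integral_ge0 => x _; rewrite lee_fin sqr_ge0.
split.
  move=> [mv]; under eq_esum do rewrite E; move=> fv.
  have Lv h : L2 mu (v h).
    split; first exact: mv.
    apply: le_lt_trans fv; apply: esum_ge; exists [set h]; first by split.
    by rewrite fsbig_set1.
  by split=> //; under eq_esum do rewrite -nsqE //.
move=> [Lv fv]; split=> [h|]; first by have [] := Lv h.
by under eq_esum do rewrite E nsqE //.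
Qed.

Lemma dot_summable u v : ell2 mu u -> ell2 mu v ->
  asummable (fun h => ip mu (u h) (v h)).
Proof.
move=> /ell2P[Lu fu] /ell2P[Lv fv].
apply: (asummable_le (a := fun h => nsq mu (u h) + nsq mu (v h))).
  move=> h; rewrite -(@ler_pXn2r _ 2) ?nnegrE ?cabs_ge0 ?addr_ge0 ?nsq_ge0 //.
  apply: le_trans (ip_cauchy_schwarz (Lu h) (Lv h)) _.
  have := nsq_ge0 mu (u h); have := nsq_ge0 mu (v h); nra.
by apply: esum_ltyD => // h; apply: nsq_ge0.
Qed.

Lemma ell2_lin (c : C) (u v : V) : ell2 mu u -> ell2 mu v -> ell2 mu (c *: u + v).
Proof.
move=> /ell2P[Lu fu] /ell2P[Lv fv]; apply/ell2P; split=> [h|].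
  exact: L2_linear.
apply: (@esum_lty _ _ _ (fun h => 2 * cabs c ^+ 2 * nsq mu (u h) + 2 * nsq mu (v h))).
  by move=> h; apply: nsq_linear_le.
have c0 : 0 <= 2 * cabs c ^+ 2 by rewrite mulr_ge0 ?sqr_ge0.
apply: esum_ltyD => [h|h||]; try by [rewrite mulr_ge0 ?nsq_ge0|].
- by apply: esum_ltyZ => // h; apply: nsq_ge0.
- by apply: esum_ltyZ => // h; apply: nsq_ge0.
Qed.

Lemma ell2_0 : ell2 mu (0 : V).
Proof.
apply/ell2P; split=> [h|]; first exact: (L2_cst mu 0).
have n0 h : nsq mu ((0 : V) h) = 0.
  apply: rc_inj; rewrite -ip_nsq /ip.
  have -> : (fun x => (0 : V) h x * ((0 : V) h x)^*) = fun=> 0.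
    by apply/funext => x; exact: mul0r.
  exact: cintegral_cst.
by under eq_esum do rewrite n0; rewrite esum1 ?ltry.
Qed.

Lemma dot_lin (c : C) (u v w : V) : ell2 mu u -> ell2 mu v -> ell2 mu w ->
  dot (c *: u + v) w = c * dot u w + dot v w.
Proof.
move=> hu hv hw; have /ell2P[Lu _] := hu; have /ell2P[Lv _] := hv; have /ell2P[Lw _] := hw.
have uw := dot_summable hu hw; have vw := dot_summable hv hw.
rewrite /Defs.dot -(csumZ c uw) -(csumD (asummableZ c uw) vw); congr csum.
by apply/funext => h; exact: ip_linear.
Qed.

Lemma dot_conj u v : ell2 mu u -> ell2 mu v -> dot u v = (dot v u)^*.
Proof.
move=> hu hv; have /ell2P[Lu _] := hu; have /ell2P[Lv _] := hv.
rewrite /Defs.dot -(csum_conj (dot_summable hv hu)); congr csum.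
by apply/funext => h; exact: ip_conj.
Qed.

Lemma dot_self v : ell2 mu v -> dot v v = rc (rsum (fun h => nsq mu (v h))).
Proof.
move=> /ell2P[Lv fv]; rewrite -csum_rc //; last by move=> h; apply: nsq_ge0.
by congr csum; apply/funext => h; exact: ip_nsq.
Qed.

Lemma dot_ge0 (v : V) : ell2 mu v -> 0 <= dot v v.
Proof.
move=> hv; rewrite dot_self // rc_ge0.
by apply: rsum_ge0 => h; apply: nsq_ge0.
Qed.

(** Riesz-Fischer with a possibly uncountable index: limits are taken almost everywhere in each
    coordinate separately, since the null sets cannot be united over [G]. Fatou's lemma is applied
    to finitely many coordinates at a time, which suffices because [esum] is a supremum over finite
    sets. *)
Lemma ell2_complete (u : nat -> V) : (forall n, ell2 mu (u n)) ->
  (forall m n, (m <= n)%N -> re (dot (u n - u m) (u n - u m)) <= 4^-1 ^+ m) ->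
  exists2 v : V, ell2 mu v & forall m, re (dot (v - u m) (v - u m)) <= 4^-1 ^+ m.
Proof.
move=> Su hu.
have SB' (a b : V) : ell2 mu a -> ell2 mu b -> ell2 mu (a - b).
  by move=> ha hb; rewrite addrC -scaleN1r; apply: ell2_lin.
have Lu n h : L2 mu (u n h) by have /ell2P[] := Su n.
have Ldiff n m h : L2 mu ((u n - u m) h).
  by have /ell2P[] := SB' _ _ (Su n) (Su m).
have hsum m n (F : {fset G}) : (m <= n)%N ->
    \sum_(h <- F) nsq mu ((u n - u m) h) <= 4^-1 ^+ m.
  move=> mn; apply: le_trans (hu m n mn); rewrite dot_self; last exact: SB'.
  have /ell2P[_ fin] := SB' _ _ (Su n) (Su m).
  by apply: sum_le_rsum => // h; apply: nsq_ge0.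
have hstep n h : nsq mu ((u n.+1 - u n) h) <= 4^-1 ^+ n.
  by have := hsum n n.+1 [fset h]%fset (leqnSn n); rewrite big_seq_fset1.
(* [p] stands for [re] or [im], so that the convergence argument is made once for both. *)
have coord (p : C -> R) : (forall z z' : C, p (z - z') = p z - p z') ->
    (forall z, `|p z| <= cabs z) ->
    (forall f, cmeas f -> measurable_fun setT (fun x : borel X => p (f x))) ->
  forall h, exists2 f : X -> R, measurable_fun setT (f : borel X -> R) &
    {ae mu, forall x, (p (u n h x) @[n --> \oo] --> f x)}.
  move=> pB pc pm h; apply: (@ae_cvg_of_rapid _ (borel X) R mu (fun n x => p (u n h x))) => n.
    by apply: pm; have [] := Lu n h.
  apply: le_trans (_ : (_ <= (nsq mu ((u n.+1 - u n) h))%:E)%E) _; last first.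
    by rewrite lee_fin.
  rewrite -nsqE //; apply: ge0_le_integral => //.
  - by move=> x _; rewrite lee_fin sqr_ge0.
  - apply/measurable_EFinP; apply: measurable_funX; apply: measurable_funB.
      by apply: pm; have [] := Lu n.+1 h.
    by apply: pm; have [] := Lu n h.
  - by apply/measurable_EFinP; apply: cmeas_cabs2; have [] := Ldiff n.+1 n h.
  - move=> x _; rewrite lee_fin -pB -(real_normK (num_real (p _))).
    by rewrite ler_pXn2r ?nnegrE ?cabs_ge0 ?normr_ge0.
have /choice[a ha] h : exists f : X -> R, measurable_fun setT (f : borel X -> R) /\
    {ae mu, forall x, (re (u n h x) @[n --> \oo] --> f x)}.
  have [||f [fm _]|f mf hf] := coord (@re R) _ _ _ h => //.
  - by move=> z z'; rewrite reD reN.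
  - exact: re_le_cabs.
  - by exists f.
have /choice[b hb] h : exists f : X -> R, measurable_fun setT (f : borel X -> R) /\
    {ae mu, forall x, (im (u n h x) @[n --> \oo] --> f x)}.
  have [||f [_ fm]|f mf hf] := coord (@im R) _ _ _ h => //.
  - by move=> z z'; rewrite imD imN.
  - exact: im_le_cabs.
  - by exists f.
pose v : V := fun h x => Complex (a h x) (b h x).
have mv h : cmeas (v h) by split; [exact: (ha h).1 | exact: (hb h).1].
have mvu h m : cmeas ((v - u m) h).
  apply: (cmeasD (f := v h) (g := fun x => - u m h x)) => //.
  have [mum _] := Lu m h.
  have := cmeasM (cmeas_cst X (-1 : C)) mum.
  by under eq_fun do rewrite mulN1r.
have aecv h : {ae mu, forall x, forall m,
    (cabs (u n h x - u m h x) ^+ 2 @[n --> \oo] --> cabs (v h x - u m h x) ^+ 2)}.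
  apply: (ae_imply2 (ha h).2 (hb h).2) => x hre him m.
  under eq_cvg do rewrite cabs_sqr reD imD !reN !imN.
  rewrite cabs_sqr reD imD reN imN /=.
  by apply: cvgD; apply: cvgM; apply: cvgB => //; exact: cvg_cst.
have key (F : {fset G}) m :
    (\int[mu]_(x in setT) (\sum_(h <- F) cabs (v h x - u m h x) ^+ 2)%:E <= (4^-1 ^+ m)%:E)%E.
  (* The sequence is shifted by [m], so that the Cauchy bound at [m] holds for all of its terms. *)
  apply: (@fatou_le _ (borel X) R mu
    (fun n x => \sum_(h <- F) cabs (u (n + m)%N h x - u m h x) ^+ 2)
    (fun x => \sum_(h <- F) cabs (v h x - u m h x) ^+ 2)).
  - by move=> n; apply: measurable_sum => h; apply: cmeas_cabs2; have [] := Ldiff (n + m)%N m h.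
  - by apply: measurable_sum => h; apply: cmeas_cabs2; exact: mvu.
  - by move=> n x; apply: sumr_ge0 => h _; exact: sqr_ge0.
  - by move=> x; apply: sumr_ge0 => h _; exact: sqr_ge0.
  - have hF := ae_all_seq (F : seq G) aecv.
    apply: (ae_imply2 hF hF) => x hx _.
    apply: (@cvg_sum_seq R _ (F : seq G)
      (fun n h => cabs (u (n + m)%N h x - u m h x) ^+ 2)) => h hhF.
    have := hx h hhF m.
    by rewrite -(@cvg_shiftn m _ (fun n => cabs (u n h x - u m h x) ^+ 2)).
  move=> n; under eq_integral do rewrite -sumEFin.
  rewrite ge0_integral_sum //.
  - under eq_bigr do rewrite (nsqE (Ldiff (n + m)%N m _)).
    by rewrite sumEFin lee_fin hsum // leq_addl.
  - by move=> h; apply/measurable_EFinP; apply: cmeas_cabs2; have [] := Ldiff (n + m)%N m h.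
  - by move=> h x _; rewrite lee_fin sqr_ge0.
have Lvu h m : L2 mu ((v - u m) h).
  split=> //; have := key [fset h]%fset m; under eq_integral do rewrite big_seq_fset1.
  by move=> /le_lt_trans; apply; exact: ltry.
have Fvu (F : {fset G}) m : \sum_(h <- F) nsq mu ((v - u m) h) <= 4^-1 ^+ m.
  have := key F m; under eq_integral do rewrite -sumEFin.
  rewrite ge0_integral_sum //.
  - under eq_bigr do rewrite (nsqE (Lvu _ m)).
    by rewrite sumEFin lee_fin.
  - by move=> h; apply/measurable_EFinP; exact: (cmeas_cabs2 (mvu h m)).
  - by move=> h x _; rewrite lee_fin sqr_ge0.
have Svu m : ell2 mu (v - u m).
  apply/ell2P; split=> //; apply: le_lt_trans (esum_leP (fun F => Fvu F m)) _; exact: ltry.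
exists v.
  (* Only differences [v - u m] have been estimated; [v] inherits square summability from one of
     them. *)
  have -> : v = 1 *: (v - u 0%N) + u 0%N by rewrite scale1r subrK.
  exact: ell2_lin.
move=> m; rewrite dot_self // re_rc -lee_fin -rsumE; last by have /ell2P[] := Svu m.
  exact: esum_leP.
by move=> h; apply: nsq_ge0.
Qed.

End ell2_space.

(** * Orthonormal bases and traces of sums of rank one operators *)

Section orthonormal_bases.
Variables (R : realType) (G : groupType) (X : ptopologicalType).
Variable mu : probability (borel X) R.
Local Notation C := (cplx R).
Local Notation V := (G -> X -> (cplx R)^o).
Local Notation dot := (dot mu).
Local Notation S := (ell2 mu : V -> Prop).

Lemma dotZl (c : C) (u v : V) : S u -> S v -> dot (c *: u) v = c * dot u v.
Proof.
exact: (@ipZl R V S dot (@ell2_0 R G X mu) (@dot_lin R G X mu)).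
Qed.

Lemma dotZr (c : C) (u v : V) : S u -> S v -> dot u (c *: v) = c^* * dot u v.
Proof.
move=> hu hv; have hcv := @subspaceZ R V S (@ell2_0 R G X mu) (@ell2_lin R G X mu) c v hv.
by rewrite dot_conj // dotZl // conjM -dot_conj.
Qed.

(** Zorn's lemma on orthonormal sets, a maximal one being indexed by itself. It supplies the basis
    in [trace_class] and determines the value of [trace]. *)
Lemma orthonormal_basis_exists :
  exists (I : choiceType) (e : I -> vec R G X), orthonormal_basis mu e.
Proof.
pose ON (A : set (vec R G X)) := (forall v, A v -> ell2 mu v /\ dot v v = 1) /\
  (forall u v, A u -> A v -> u <> v -> dot u v = 0).
have [|A [[A1 A2] Amax]] := @Zorn_bigcup _ ON.
  move=> F FON Ftot; split.
    by move=> v [B FB Bv]; have [h _] := FON _ FB; apply: h.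
  move=> u v [B FB Bu] [B' FB' Bv] uv.
  have [BB|BB] := Ftot _ _ FB FB'.
    by have [_ h] := FON _ FB'; apply: h => //; apply: BB.
  by have [_ h] := FON _ FB; apply: h => //; apply: BB.
exists (set_type A), (fun i => val i); split.
- by move=> i; have /A1[] := set_valP i.
- move=> i j; case: (eqVneq i j) => [->|ij].
    by have /A1[_ ->] := set_valP j.
  apply: A2; [exact: set_valP | exact: set_valP |].
  by move=> /val_inj/eqP; apply/negP.
move=> v hv vA; apply/eqP/negPn/negP => vv0.
have vvE := dot_self hv; set r := rsum _ in vvE.
have r0 : 0 < r.
  rewrite lt_def; apply/andP; split; last by apply: rsum_ge0 => h; exact: nsq_ge0.
  by apply: contraNneq vv0 => r0; rewrite vvE r0.
(* A vector of nonzero norm orthogonal to [A], once normalised, would enlarge [A]. *)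
pose w : V := rc (Num.sqrt r)^-1 *: (v : V).
have hw : ell2 mu w by exact: (@subspaceZ R V S (@ell2_0 R G X mu) (@ell2_lin R G X mu)).
have ww : dot w w = 1.
  rewrite /w dotZl // dotZr // conj_rc vvE -!rcM; congr rc.
  by rewrite mulrA -invfM -expr2 (sqr_sqrtr (ltW r0)) mulVf // gt_eqF.
have wA a : A a -> dot w a = 0.
  move=> Aa; have [ha _] := A1 _ Aa; rewrite /w dotZl //.
  by have := vA (SigSub (mem_set Aa)); rewrite /= => ->; rewrite mulr0.
have nAw : ~ A w.
  by move=> /wA; rewrite ww => /eqP; rewrite oner_eq0.
apply: (Amax (A `|` [set w])).
  split; first by move=> x Ax; left.
  by move=> /(_ w) h; apply: nAw; apply: h; right.
split.
  by move=> x [/A1 //|->].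
move=> x y [Ax|->] [Ay|->] // xy.
- exact: A2.
- by have [hx _] := A1 _ Ax; rewrite dot_conj // wA // conjC0.
- exact: wA.
Qed.

Section basis.
Variables (I : choiceType) (e : I -> V).
Hypothesis eB : orthonormal_basis mu e.

Lemma dot_parseval (u v : V) : S u -> S v ->
  csum (fun i => dot u (e i) * dot (e i) v) = dot u v.
Proof.
case: eB => Se eON emax.
exact: (@parseval_product R V S dot (@ell2_0 R G X mu) (@ell2_lin R G X mu)
  (@dot_lin R G X mu) (@dot_conj R G X mu) (@dot_ge0 R G X mu) I e Se eON
  (@ell2_complete R G X mu) emax).
Qed.

Lemma dot_bessel_product (u v : V) : S u -> S v ->
  (asum (fun i => dot u (e i) * dot (e i) v)%R <=
   (Num.sqrt (re (dot u u)) * Num.sqrt (re (dot v v)))%:E)%E.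
Proof.
case: eB => Se eON _ Su Sv; apply: esum_leP => J.
exact: (@bessel_product R V S dot (@ell2_0 R G X mu) (@ell2_lin R G X mu)
  (@dot_lin R G X mu) (@dot_conj R G X mu) (@dot_ge0 R G X mu) I e Se eON).
Qed.

End basis.

Definition delta_vec (h : G) (w : X -> C) : V := fun k x => if k == h then w x else 0.

Lemma ip_0l f : ip mu (fun=> 0) f = 0.
Proof. by rewrite /ip; under eq_fun do rewrite mul0r; rewrite cintegral_cst. Qed.

Lemma ip_0r f : ip mu f (fun=> 0) = 0.
Proof. by rewrite /ip; under eq_fun do rewrite conjC0 mulr0; rewrite cintegral_cst. Qed.

Lemma nsq_0 : nsq mu (fun=> 0) = 0.
Proof. by apply: rc_inj; rewrite -ip_nsq ip_0l. Qed.

Lemma delta_vec_same h w : delta_vec h w h = w.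
Proof. by rewrite /delta_vec eqxx. Qed.

Lemma delta_vec_other h k w : k != h -> delta_vec h w k = fun=> 0.
Proof. by rewrite /delta_vec => /negbTE ->. Qed.

Lemma ell2_delta_vec h w : L2 mu w -> S (delta_vec h w).
Proof.
move=> Lw; apply/ell2P; split=> [k|].
  rewrite /delta_vec; case: (k == h) => //; exact: (L2_cst mu 0).
have := @asummable_single R G (fun k => rc (nsq mu (delta_vec h w k))) h.
have aE k : cabs (rc (nsq mu (delta_vec h w k))) = nsq mu (delta_vec h w k).
  by rewrite cabs_rc ger0_norm ?nsq_ge0.
rewrite /asummable /asum; under eq_esum do rewrite aE; apply => k kh.
by rewrite delta_vec_other // nsq_0.
Qed.

Lemma dot_delta_r (v : V) h w : dot v (delta_vec h w) = ip mu (v h) w.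
Proof.
have := @csum_single R G (fun k => ip mu (v k) (delta_vec h w k)) h.
rewrite delta_vec_same => H; apply: csum_to_csum; apply: H => k kh.
by rewrite delta_vec_other // ip_0r.
Qed.

Lemma dot_delta_l (v : V) h w : dot (delta_vec h w) v = ip mu w (v h).
Proof.
have := @csum_single R G (fun k => ip mu (delta_vec h w k) (v k)) h.
rewrite delta_vec_same => H; apply: csum_to_csum; apply: H => k kh.
by rewrite delta_vec_other // ip_0l.
Qed.

Lemma nn_delta h w : re (dot (delta_vec h w) (delta_vec h w)) = nsq mu w.
Proof. by rewrite dot_delta_r delta_vec_same ip_nsq. Qed.

(* Operators that are a sum over [h] of the rank one operators
   [<-, delta_(s h) w_h> delta_h u_h]. *)
Definition rank_one_sum (s : G -> G) (u w : G -> X -> C) (v : vec R G X) : vec R G X :=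
  fun h x => ip mu (v (s h)) (w h) * u h x.

Section trace_of_rank_one_sum.
Variables (I : choiceType) (e : I -> V) (s : G -> G) (u w : G -> X -> C).
Hypothesis eB : orthonormal_basis mu e.
Hypothesis Lu : forall h, L2 mu (u h).
Hypothesis Lw : forall h, L2 mu (w h).
Hypothesis fin : (\esum_(h in [set: G])
  (Num.sqrt (nsq mu (u h)) * Num.sqrt (nsq mu (w h)))%:E < +oo)%E.

(** The contribution of the rank one term at [h] to the diagonal entry at [e i]. Summing over [h]
    first gives the diagonal of the operator, summing over [i] first gives Parseval. *)
Let F h i := dot (delta_vec h (u h)) (e i) * dot (e i) (delta_vec (s h) (w h)).

Let dot_rank_one_sum i : dot (rank_one_sum s u w (e i)) (e i) = csum (F ^~ i).
Proof.
case: eB => Se _ _; have /ell2P[Le _] := Se i.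
congr csum; apply/funext => h; rewrite /F dot_delta_l dot_delta_r mulrC.
have := ip_linear (ip mu (e i (s h)) (w h)) (Lu h) (L2_cst mu 0) (Le h).
rewrite ip_0l addr0 => <-; rewrite /ip /rank_one_sum.
by congr cintegral; apply/funext => x; rewrite addr0.
Qed.

Let F_fin : (\esum_(h in [set: G]) asum (F h) < +oo)%E.
Proof.
apply: le_lt_trans fin; apply: le_esum => h _.
have Su := ell2_delta_vec h (Lu h); have Sw := ell2_delta_vec (s h) (Lw h).
by have := dot_bessel_product eB Su Sw; rewrite !nn_delta.
Qed.

Lemma rank_one_sum_asummable :
  asummable (fun i => dot (rank_one_sum s u w (e i)) (e i)).
Proof.
have := fubini_summable (fubini_swap F_fin).
by under [X in asummable X -> _]eq_fun do rewrite -dot_rank_one_sum.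
Qed.

(** After the exchange of sums, Parseval turns the term at [h] into the inner product of vectors
    supported at [h] and at [s h]. It vanishes off the fixed points of [s], and the basis has
    disappeared. *)
Lemma trace_rank_one_sum :
  csum (fun i => dot (rank_one_sum s u w (e i)) (e i)) =
  csum (fun h => if s h == h then ip mu (u h) (w h) else 0).
Proof.
under eq_fun do rewrite dot_rank_one_sum.
rewrite -(csum_exchange F_fin); congr csum; apply/funext => h.
have Su := ell2_delta_vec h (Lu h); have Sw := ell2_delta_vec (s h) (Lw h).
rewrite /F dot_parseval // dot_delta_l /delta_vec eq_sym.
by case: (s h == h) => //; exact: ip_0r.
Qed.

End trace_of_rank_one_sum.
End orthonormal_bases.

(** * Operators with fibres of rank two *)

Section rank_two_fibres.
Variables (R : realType) (G : groupType) (X : ptopologicalType).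
Variable mu : probability (borel X) R.
Local Notation C := (cplx R).
Local Notation V := (G -> X -> (cplx R)^o).
Local Notation dot := (dot mu).
Local Notation ros := (rank_one_sum mu).
Implicit Types (T : vec R G X -> vec R G X).

Lemma dotE (u v : vec R G X) : dot u v = csum (fun h => ip mu (u h) (v h)).
Proof. by []. Qed.

Definition add_op T1 T2 : vec R G X -> vec R G X := fun v h x => T1 v h x + T2 v h x.

Lemma dot_eq0 (v : V) : (forall h x, v h x = 0) -> dot v v = 0.
Proof.
move=> v0; rewrite dotE -[RHS](@csum0 R G); congr csum; apply/funext => h.
have -> : v h = fun=> 0 by apply/funext => x; exact: v0.
exact: ip_0l.
Qed.

Lemma ell2_add (u v : V) : ell2 mu u -> ell2 mu v -> ell2 mu (fun h x => u h x + v h x).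
Proof. by move=> hu hv; have := ell2_lin 1 hu hv; rewrite scale1r. Qed.

Lemma dot_addl (u v w : V) : ell2 mu u -> ell2 mu v -> ell2 mu w ->
  dot (fun h x => u h x + v h x) w = dot u w + dot v w.
Proof. by move=> hu hv hw; have := dot_lin 1 hu hv hw; rewrite scale1r mul1r. Qed.

Lemma nn_add_le (u v : V) : ell2 mu u -> ell2 mu v ->
  re (dot (fun h x => u h x + v h x) (fun h x => u h x + v h x)) <=
  2 * re (dot u u) + 2 * re (dot v v).
Proof.
exact: (@nnD_le R V (ell2 mu) dot (@ell2_lin R G X mu) (@dot_lin R G X mu)
  (@dot_conj R G X mu) (@dot_ge0 R G X mu)).
Qed.

(** Linearity is asked for pointwise: [bounded_operator] yields it only up to null vectors, whereas
    it is exact for the concrete operators below. *)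
Lemma bounded_add T1 T2 : bounded_operator mu T1 -> bounded_operator mu T2 ->
  (forall c u v, ell2 mu u -> ell2 mu v -> forall h x,
    add_op T1 T2 (fun h x => c * u h x + v h x) h x =
    c * add_op T1 T2 u h x + add_op T1 T2 v h x) ->
  bounded_operator mu (add_op T1 T2).
Proof.
move=> [S1 _ [M1 h1]] [S2 _ [M2 h2]] lin; split.
- by move=> v hv; apply: ell2_add; [exact: S1 | exact: S2].
- move=> c u v hu hv w; apply: dot_eq0 => h x.
  by rewrite /w lin // subrr.
exists (2 * M1 + 2 * M2) => v hv; apply: le_trans (nn_add_le (S1 _ hv) (S2 _ hv)) _.
apply: (@le_trans _ _ (2 * (M1 * re (dot v v)) + 2 * (M2 * re (dot v v)))).
  by apply: lerD; rewrite ler_pM2l //; [exact: h1 | exact: h2].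
by rewrite !mulrA -mulrDl lexx.
Qed.

Lemma bounded_ext T T' : (forall v, ell2 mu v -> T' v = T v) ->
  bounded_operator mu T -> bounded_operator mu T'.
Proof.
move=> TT [S1 lin [M hM]]; split.
- by move=> v hv; rewrite (TT v hv); exact: S1.
- move=> c u v hu hv /=; have hw : ell2 mu (fun h x => c * u h x + v h x).
    exact: (ell2_lin c hu hv).
  by have := lin c u v hu hv; rewrite /= !TT.
by exists M => v hv; rewrite (TT v hv); exact: hM.
Qed.

Lemma ros_linear s (u w : G -> X -> C) c (a b : vec R G X) :
  (forall h, L2 mu (w h)) -> ell2 mu a -> ell2 mu b -> forall h x,
  ros s u w (fun h x => c * a h x + b h x) h x = c * ros s u w a h x + ros s u w b h x.
Proof.
move=> Lw /ell2P[La _] /ell2P[Lb _] h x.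
by rewrite /rank_one_sum ip_linear //; ring.
Qed.

(** Distinct terms have orthogonal ranges and read distinct coordinates of [v], so a uniform bound
    on the terms is enough; [s] being a bijection, the coordinates read add up to the norm of
    [v]. *)
Lemma bounded_ros s t (u w : G -> X -> C) (M : R) : cancel s t -> cancel t s ->
  (forall h, L2 mu (u h)) -> (forall h, L2 mu (w h)) ->
  (forall h, nsq mu (u h) * nsq mu (w h) <= M) ->
  bounded_operator mu (ros s u w).
Proof.
move=> st ts Lu Lw uwM.
have M0 : 0 <= M.
  by apply: le_trans (uwM 1%g); rewrite mulr_ge0 ?nsq_ge0.
have fin v : ell2 mu v ->
    (\esum_(h in [set: G]) (nsq mu (v (s h)))%:E < +oo)%E /\
    rsum (fun h => nsq mu (v (s h))) = rsum (fun h => nsq mu (v h)).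
  move=> /ell2P[_ fv]; have sb : set_bij [set: G] [set: G] s.
    split=> //; first by move=> i j _ _; apply: can_inj st _ _.
    by move=> j _; exists (t j).
  by rewrite /rsum -(@reindex_esum R G G _ _ s (fun h => (nsq mu (v h))%:E) sb).
have Lros v h : L2 mu (ros s u w v h).
  have := L2_linear (ip mu (v (s h)) (w h)) (Lu h) (L2_cst mu 0).
  by under [X in L2 mu X -> _]eq_fun do rewrite addr0.
have nros v h : ell2 mu v -> nsq mu (ros s u w v h) <= M * nsq mu (v (s h)).
  move=> /ell2P[Lv _]; rewrite nsqZ //.
  apply: (@le_trans _ _ ((nsq mu (v (s h)) * nsq mu (w h)) * nsq mu (u h))).
    by rewrite ler_wpM2r ?nsq_ge0 // ip_cauchy_schwarz.
  by rewrite -mulrA mulrC ler_wpM2r ?nsq_ge0 // mulrC uwM.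
have Sros v : ell2 mu v -> ell2 mu (ros s u w v).
  move=> hv; apply/ell2P; split=> //.
  apply: (@esum_lty _ _ _ (fun h => M * nsq mu (v (s h)))); first by move=> h; exact: nros.
  by apply: esum_ltyZ => // [h|]; [exact: nsq_ge0 | case: (fin v hv)].
split; first exact: Sros.
  move=> c a b ha hb z; apply: dot_eq0 => h x.
  by rewrite /z ros_linear // subrr.
exists M => v hv; rewrite (dot_self hv) (dot_self (Sros v hv)).
rewrite !re_rc; have [f1 f2] := fin v hv; rewrite -f2 -lee_fin -rsumE; first last.
- by have /ell2P[] := Sros v hv.
- by move=> h; exact: nsq_ge0.
apply: esum_leP => J; apply: (@le_trans _ _ (M * \sum_(h <- J) nsq mu (v (s h)))).
  by rewrite mulr_sumr; apply: ler_sum => h _; exact: nros.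
by rewrite ler_wpM2l //; apply: sum_le_rsum => // h; exact: nsq_ge0.
Qed.

Lemma ip_orthogonal_pair (x1 x2 y1 y2 : C) (a b : X -> C) : L2 mu a -> L2 mu b ->
  ip mu a b = 0 ->
  ip mu (fun x => x1 * a x + x2 * b x) (fun x => y1 * a x + y2 * b x) =
  x1 * y1^* * rc (nsq mu a) + x2 * y2^* * rc (nsq mu b).
Proof.
move=> La Lb ab; have L c (f : X -> C) : L2 mu f -> L2 mu (fun x => c * f x).
  move=> Lf; have := L2_linear c Lf (L2_cst mu 0).
  by under [X in L2 mu X -> _]eq_fun do rewrite addr0.
have ipZ c f g : L2 mu f -> L2 mu g -> ip mu (fun x => c * f x) g = c * ip mu f g.
  move=> Lf Lg; have := ip_linear c Lf (L2_cst mu 0) Lg.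
  by under eq_fun do rewrite addr0; rewrite ip_0l addr0.
have Ly : L2 mu (fun x => y1 * a x + y2 * b x) by apply: L2_linear => //; exact: L.
have ba : ip mu b a = 0.
  by rewrite ip_conj // ab conjC0.
rewrite ip_linear //; last exact: L.
rewrite ipZ // [ip mu a _]ip_conj // [ip mu b _]ip_conj // !ip_linear //; try exact: L.
by rewrite !ipZ // ab ba !ip_nsq !mulr0 addr0 add0r !conjM !conj_rc !mulrA.
Qed.

Section two_terms.
Variables (s t : G -> G) (u w u' w' : G -> X -> C) (T : vec R G X -> vec R G X).
Hypotheses (st : cancel s t) (ts : cancel t s).
Hypotheses (Lu : forall h, L2 mu (u h)) (Lw : forall h, L2 mu (w h)).
Hypotheses (Lu' : forall h, L2 mu (u' h)) (Lw' : forall h, L2 mu (w' h)).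
Hypotheses (uu' : forall h, ip mu (u h) (u' h) = 0).
Hypotheses (ww' : forall h, ip mu (w h) (w' h) = 0).
Hypothesis fin : (\esum_(h in [set: G])
  (Num.sqrt (nsq mu (u h)) * Num.sqrt (nsq mu (w h)))%:E < +oo)%E.
Hypothesis fin' : (\esum_(h in [set: G])
  (Num.sqrt (nsq mu (u' h)) * Num.sqrt (nsq mu (w' h)))%:E < +oo)%E.
(** Required on [ell2] only, since the integrals inside such operators are additive only on
    integrable functions. *)
Hypothesis TE : forall v, ell2 mu v -> T v = add_op (ros s u w) (ros s u' w') v.

Lemma sqrt_sum_bound (a b : G -> R) : (forall h, 0 <= a h) -> (forall h, 0 <= b h) ->
  (\esum_(h in [set: G]) (Num.sqrt (a h) * Num.sqrt (b h))%:E < +oo)%E ->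
  exists M, forall h, a h * b h <= M.
Proof.
move=> a0 b0 ab; set r := fun h => Num.sqrt (a h) * Num.sqrt (b h) in ab *.
have r0 h : 0 <= r h by rewrite mulr_ge0 ?sqrtr_ge0.
exists (rsum r ^+ 2) => h.
rewrite -[a h]sqr_sqrtr // -[b h]sqr_sqrtr // -exprMn.
by apply: lerXn2r; rewrite ?nnegrE; [exact: r0 | exact: rsum_ge0 | exact: (le_rsum r0 ab h)].
Qed.

(** The data are arbitrary because the lemma serves both for [T] and for its modulus, whose
    translation is the identity. *)
Lemma two_terms_bounded (a b a' b' : G -> X -> C) s' t' : cancel s' t' -> cancel t' s' ->
  (forall h, L2 mu (a h)) -> (forall h, L2 mu (b h)) ->
  (forall h, L2 mu (a' h)) -> (forall h, L2 mu (b' h)) ->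
  (\esum_(h in [set: G]) (Num.sqrt (nsq mu (a h)) * Num.sqrt (nsq mu (b h)))%:E < +oo)%E ->
  (\esum_(h in [set: G]) (Num.sqrt (nsq mu (a' h)) * Num.sqrt (nsq mu (b' h)))%:E < +oo)%E ->
  [/\ bounded_operator mu (ros s' a b), bounded_operator mu (ros s' a' b') &
   bounded_operator mu (add_op (ros s' a b) (ros s' a' b'))].
Proof.
move=> st' ts' La Lb La' Lb' f1 f2.
have n0 (f : G -> X -> C) h : 0 <= nsq mu (f h) by exact: nsq_ge0.
have [M hM] := sqrt_sum_bound (n0 a) (n0 b) f1.
have [M' hM'] := sqrt_sum_bound (n0 a') (n0 b') f2.
have b1 := bounded_ros st' ts' La Lb hM; have b2 := bounded_ros st' ts' La' Lb' hM'.
split; [exact: b1 | exact: b2 | apply: (bounded_add b1 b2) => c x y hx hy h z].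
by rewrite /add_op !ros_linear //; ring.
Qed.

Lemma two_terms_diagonal (I : choiceType) (e : I -> vec R G X) (a b a' b' : G -> X -> C) s' t' :
  cancel s' t' -> cancel t' s' -> orthonormal_basis mu e ->
  (forall h, L2 mu (a h)) -> (forall h, L2 mu (b h)) ->
  (forall h, L2 mu (a' h)) -> (forall h, L2 mu (b' h)) ->
  (\esum_(h in [set: G]) (Num.sqrt (nsq mu (a h)) * Num.sqrt (nsq mu (b h)))%:E < +oo)%E ->
  (\esum_(h in [set: G]) (Num.sqrt (nsq mu (a' h)) * Num.sqrt (nsq mu (b' h)))%:E < +oo)%E ->
  asummable (fun i => dot (add_op (ros s' a b) (ros s' a' b') (e i)) (e i)) /\
  csum (fun i => dot (add_op (ros s' a b) (ros s' a' b') (e i)) (e i)) =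
  csum (fun h => if s' h == h then ip mu (a h) (b h) else 0) +
  csum (fun h => if s' h == h then ip mu (a' h) (b' h) else 0).
Proof.
move=> st' ts' eB La Lb La' Lb' f1 f2.
have [[S1 _ _] [S2 _ _] _] := two_terms_bounded st' ts' La Lb La' Lb' f1 f2.
have [Se _ _] := eB.
have E : (fun i => dot (add_op (ros s' a b) (ros s' a' b') (e i)) (e i)) =
    fun i => dot (ros s' a b (e i)) (e i) + dot (ros s' a' b' (e i)) (e i).
  by apply/funext => i; apply: dot_addl => //; [exact: S1 | exact: S2].
have a1 := rank_one_sum_asummable s' eB La Lb f1.
have a2 := rank_one_sum_asummable s' eB La' Lb' f2.
rewrite E; split; first exact: asummableD.
by rewrite (csumD a1 a2) !trace_rank_one_sum.
Qed.

(* The coefficient [|u| / |w|] of the modulus of a rank one operator, equal to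
   0 (as x / 0 = 0) when [w] vanishes. *)
Let al h : C := rc (Num.sqrt (nsq mu (u h)) / Num.sqrt (nsq mu (w h))).
Let al' h : C := rc (Num.sqrt (nsq mu (u' h)) / Num.sqrt (nsq mu (w' h))).
(** The modulus lives on the source: coordinate [h] of a vector is read by the term of index [t h],
    whence the functions [w (t h)] and the translation [id]. *)
Let A := add_op (ros id (fun h x => al (t h) * w (t h) x) (fun h => w (t h)))
                (ros id (fun h x => al' (t h) * w' (t h) x) (fun h => w' (t h))).

Let L2Z c (f : X -> C) : L2 mu f -> L2 mu (fun x => c * f x).
Proof.
move=> Lf; have := L2_linear c Lf (L2_cst mu 0).
by under [X in L2 mu X -> _]eq_fun do rewrite addr0.
Qed.

(** Passing to the modulus keeps the products of norms, up to the reindexing by [t]; where [b] is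
    null the new product is 0. *)
Let modulus_fin (a b : G -> X -> C) : (forall h, L2 mu (b h)) ->
  (\esum_(h in [set: G]) (Num.sqrt (nsq mu (a h)) * Num.sqrt (nsq mu (b h)))%:E < +oo)%E ->
  (\esum_(h in [set: G]) (Num.sqrt (nsq mu (fun x =>
      rc (Num.sqrt (nsq mu (a (t h))) / Num.sqrt (nsq mu (b (t h)))) * b (t h) x)) *
    Num.sqrt (nsq mu (b (t h))))%:E < +oo)%E.
Proof.
move=> Lb fab.
have tb : set_bij [set: G] [set: G] t.
  split=> //; first by move=> i j _ _; apply: can_inj ts _ _.
  by move=> j _; exists (s j).
move: fab; rewrite (@reindex_esum R G G _ _ t (fun h => (Num.sqrt (nsq mu (a h)) *
  Num.sqrt (nsq mu (b h)))%:E) tb).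
apply: esum_lty => h; rewrite nsqZ // cabs_rc.
rewrite real_normK ?num_real // sqrtrM ?sqr_ge0 // sqrtr_sqr ger0_norm; last first.
  by rewrite divr_ge0 ?sqrtr_ge0.
rewrite ler_wpM2r ?sqrtr_ge0 //.
have [->|n0] := eqVneq (Num.sqrt (nsq mu (b (t h)))) 0.
  by rewrite mulr0 sqrtr_ge0.
by rewrite divfK.
Qed.

(** In general [c^2 |b|^2 = |a|^2]. If [b] is null then [c] is 0 by convention, but Cauchy-Schwarz
    makes [<x,b>] vanish on both sides. *)
Let modulus_coef (a b : X -> C) (x y : X -> C) : L2 mu b -> L2 mu x -> L2 mu y ->
  let c : C := rc (Num.sqrt (nsq mu a) / Num.sqrt (nsq mu b)) in
  c * c * rc (nsq mu b) * ip mu x b * (ip mu y b)^* =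
  ip mu x b * (ip mu y b)^* * rc (nsq mu a).
Proof.
move=> Lb Lx Ly c; have [n0|n0] := eqVneq (nsq mu b) 0.
  have -> : ip mu x b = 0; last by rewrite !mulr0 !mul0r.
  apply/cabs_eq0/eqP; rewrite -sqrf_eq0; apply/eqP/le_anti.
  by rewrite sqr_ge0 andbT (le_trans (ip_cauchy_schwarz Lx Lb)) // n0 mulr0.
have -> : c * c * rc (nsq mu b) = rc (nsq mu a); last by ring.
rewrite /c -!rcM; congr rc; rewrite -expr2 expr_div_n !sqr_sqrtr ?nsq_ge0 //.
by rewrite divfK.
Qed.

(** [T^* T] has no cross terms because [u] is orthogonal to [u'], and [A^2] has none because [w] is
    orthogonal to [w']; [modulus_coef] matches what remains. Positivity holds since [<A v, v>] is a
    sum of squares with nonnegative weights. *)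
Lemma two_terms_trace_class : trace_class mu T.
Proof.
have [_ _ b1] := two_terms_bounded st ts Lu Lw Lu' Lw' fin fin'.
have bT : bounded_operator mu T := bounded_ext TE b1.
have LA h : L2 mu (fun x => al (t h) * w (t h) x) by exact: L2Z.
have LA' h : L2 mu (fun x => al' (t h) * w' (t h) x) by exact: L2Z.
have f1 := modulus_fin Lw fin; have f2 := modulus_fin Lw' fin'.
have ii : cancel (@id G) (@id G) by [].
have Lwt h : L2 mu (w (t h)) by []. have Lwt' h : L2 mu (w' (t h)) by [].
have [_ _ bA] := two_terms_bounded ii ii LA Lwt LA' Lwt' f1 f2.
have [SA _ _] := bA; have [ST _ _] := bT.
split; first exact: bT.
exists A; last first.
  have [I [e eB]] := orthonormal_basis_exists G mu; exists I, e; split=> //.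
  have [asA _] := two_terms_diagonal ii ii eB LA Lwt LA' Lwt' f1 f2.
  by apply: esum_lty asA => i; apply: le_trans (re_le_cabs _); exact: ler_norm.
have AE v h : A v h = fun x => ip mu (v h) (w (t h)) * al (t h) * w (t h) x +
    ip mu (v h) (w' (t h)) * al' (t h) * w' (t h) x.
  by apply/funext => x; rewrite /A /add_op /rank_one_sum !mulrA.
have wOwn (f : X -> C) (a b : X -> C) (c d : C) : L2 mu a -> L2 mu b -> ip mu a b = 0 ->
    f = (fun x => c * a x + d * b x) ->
    ip mu f a = c * rc (nsq mu a) /\ ip mu f b = d * rc (nsq mu b).
  move=> La Lb ab ->; split.
    have := ip_orthogonal_pair c d 1 0 La Lb ab.
    under [X in ip mu _ X = _ -> _]eq_fun do rewrite mul1r mul0r addr0.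
    by rewrite conjC1 conjC0 mulr1 mulr0 mul0r addr0.
  have := ip_orthogonal_pair c d 0 1 La Lb ab.
  under [X in ip mu _ X = _ -> _]eq_fun do rewrite mul1r mul0r add0r.
  by rewrite conjC1 conjC0 mulr1 mulr0 mul0r add0r.
have ipA (x : X -> C) (y : vec R G X) h : L2 mu x -> (forall h, L2 mu (y h)) ->
    ip mu (A y h) x = ip mu (y h) (w (t h)) * al (t h) * ip mu (w (t h)) x +
    ip mu (y h) (w' (t h)) * al' (t h) * ip mu (w' (t h)) x.
  move=> Lx Ly; rewrite AE ip_linear //; last exact: L2Z.
  congr (_ + _); have := ip_linear (ip mu (y h) (w' (t h)) * al' (t h)) (Lwt' h) (L2_cst mu 0) Lx.
  by under eq_fun do rewrite addr0; rewrite ip_0l addr0.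
split; first exact: bA.
- move=> v hv; have /ell2P[Lv _] := hv; have as_ := dot_summable (SA v hv) hv.
  pose a h := re (al (t h)) * cabs (ip mu (v h) (w (t h))) ^+ 2 +
    re (al' (t h)) * cabs (ip mu (v h) (w' (t h))) ^+ 2.
  have aE h : ip mu (A v h) (v h) = rc (a h).
    rewrite ipA // [ip mu (w _) _]ip_conj // [ip mu (w' _) _]ip_conj //.
    rewrite mulrAC mul_conj [X in _ + X]mulrAC mul_conj /a rcD.
    rewrite (rcM (re (al (t h)))) (rcM (re (al' (t h)))).
    by congr (_ + _); exact: mulrC.
  have a0 h : 0 <= a h.
    by rewrite addr_ge0 // mulr_ge0 ?sqr_ge0 // /al /al' re_rc divr_ge0 ?sqrtr_ge0.
  rewrite dotE (_ : (fun h => _) = fun h => rc (a h)); last exact/funext.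
  rewrite csum_rc ?rc_ge0 ?rsum_ge0 //.
  move: as_; rewrite /asummable /asum; under eq_esum do rewrite aE cabs_rc ger0_norm //.
  by [].
move=> x y hx hy; have /ell2P[Lx _] := hx; have /ell2P[Ly _] := hy.
have TT h : ip mu (T x h) (T y h) =
    ip mu (x (s h)) (w h) * (ip mu (y (s h)) (w h))^* * rc (nsq mu (u h)) +
    ip mu (x (s h)) (w' h) * (ip mu (y (s h)) (w' h))^* * rc (nsq mu (u' h)).
  by rewrite !TE // ip_orthogonal_pair.
(* The fibre of [A^2] at [h] is compared with that of [T^* T] at [t h]; the sums agree after
   reindexing. *)
have AA h : ip mu (A (A x) h) (y h) = ip mu (T x (t h)) (T y (t h)).
  rewrite TT ts ipA //; last by have /ell2P[] := SA x hx.
  have [-> ->] := wOwn (A x h) _ _ _ _ (Lwt h) (Lwt' h) (ww' (t h)) (AE x h).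
  rewrite [ip mu (w _) _]ip_conj // [ip mu (w' _) _]ip_conj //.
  rewrite -(modulus_coef (u (t h)) (Lwt h) (Lx h) (Ly h)).
  by rewrite -(modulus_coef (u' (t h)) (Lwt' h) (Lx h) (Ly h)) -/(al _) -/(al' _); ring.
apply: csum_to_csum.
have := csum_to_reindex ts st (asummable_csum (dot_summable (ST x hx) (ST y hy))).
by rewrite (_ : _ \o t = fun h => ip mu (A (A x) h) (y h)) //; apply/funext => h; rewrite AA.
Qed.

(** [xget] returns some number with property [P]. The right-hand side has it, and evaluation on one
    existing basis leaves no other choice. *)
Lemma two_terms_trace : trace mu T =
  csum (fun h => if s h == h then ip mu (u h) (w h) else 0) +
  csum (fun h => if s h == h then ip mu (u' h) (w' h) else 0).
Proof.
set z := (X in _ = X); pose P (y : C) := forall (I : choiceType) (e : I -> vec R G X),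
  orthonormal_basis mu e -> csum_to (fun i => dot (T (e i)) (e i)) y.
have Pz : P z.
  move=> I e eB; have [Se _ _] := eB.
  have -> : (fun i => dot (T (e i)) (e i)) =
      fun i => dot (add_op (ros s u w) (ros s u' w') (e i)) (e i).
    by apply/funext => i; rewrite TE.
  have [as_ E] := two_terms_diagonal st ts eB Lu Lw Lu' Lw' fin fin'.
  rewrite /z -E; exact: asummable_csum.
have [I [e eB]] := orthonormal_basis_exists G mu.
have Pt : P (trace mu T) by exact: (@xgetPex _ 0 P (ex_intro _ z Pz)).
exact: (csum_to_unique (Pt I e eB) (Pz I e eB)).
Qed.

End two_terms.
End rank_two_fibres.

(** * Products of commutators *)

Section fibre_commutators.
Variables (R : realType) (X : ptopologicalType) (mu : probability (borel X) R).
Local Notation C := (cplx R).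
Local Notation "'I" := (cintegral mu).
Implicit Types F y f : X -> C.

Definition fibre_comm F y : X -> C := fun x => 'I (fun z => F z * y z) - F x * 'I y.

(** Bounded measurable functions: they multiply [L2] into itself and are stable under centering and
    conjugation. *)
Definition tame F : Prop := cmeas F /\ exists M, forall x, cabs (F x) <= M.

Definition centered F : X -> C := fun x => F x - 'I F.

Definition fcov F f : C := 'I (fun x => F x * f x) - 'I F * 'I f.

Lemma tame_L2 F : tame F -> L2 mu F.
Proof. by move=> [mF [M FM]]; exact: L2_bounded FM. Qed.

Lemma tame_mul F y : tame F -> L2 mu y -> L2 mu (fun x => F x * y x).
Proof. by move=> [mF [M FM]] Ly; exact: L2_mul_bounded FM Ly. Qed.

Lemma tame_centered F : tame F -> tame (centered F).
Proof.
move=> [mF [M FM]]; split; first exact: (cmeasD mF (cmeas_cst X (- 'I F))).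
exists (M + cabs ('I F)) => x.
by rewrite (le_trans (cabsD _ _)) // cabsN lerD2r.
Qed.

Lemma tame_conj F : tame F -> tame (fun x => (F x)^*).
Proof.
move=> [mF [M FM]]; split; first exact: cmeas_conj.
by exists M => x; rewrite cabs_conj.
Qed.

Lemma cintegral_comb (a b : C) f y : L2 mu f -> L2 mu y ->
  'I (fun x => a * f x + b * y x) = a * 'I f + b * 'I y.
Proof.
move=> /L2_cintegrable If /L2_cintegrable Iy.
by rewrite (cintegralD (cintegrableZ a If) (cintegrableZ b Iy)) (cintegralZ a If) (cintegralZ b Iy).
Qed.

Lemma cintegral_centered F : tame F -> 'I (centered F) = 0.
Proof.
move=> tF; have := cintegral_comb 1 (- 'I F) (tame_L2 tF) (L2_cst mu 1).
rewrite (cintegral_cst mu 1) mulr1 mul1r subrr => <-; congr cintegral.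
by apply/funext => x; rewrite /centered mul1r.
Qed.

Lemma cintegral_centered_mul F y : tame F -> L2 mu y ->
  'I (fun x => centered F x * y x) = 'I (fun x => F x * y x) - 'I F * 'I y.
Proof.
move=> tF Ly; rewrite -[in RHS]mulNr -[X in X + _]mul1r -cintegral_comb //; last exact: tame_mul.
by congr cintegral; apply/funext => x; rewrite /centered; ring.
Qed.

Lemma fcovC F f : fcov F f = fcov f F.
Proof.
rewrite /fcov [_ * 'I f]mulrC; congr (cintegral _ _ - _).
by apply/funext => x; rewrite mulrC.
Qed.

Lemma fcov_centered F f : tame F -> tame f ->
  fcov F f = 'I (fun x => centered F x * centered f x).
Proof.
move=> tF tf; have Lf := tame_L2 (tame_centered tf).
rewrite cintegral_centered_mul // cintegral_centered // mulr0 subr0.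
rewrite (_ : 'I (fun x => F x * centered f x) = 'I (fun x => centered f x * F x)); last first.
  by congr cintegral; apply/funext => x; rewrite mulrC.
rewrite cintegral_centered_mul //; last exact: tame_L2.
exact: fcovC.
Qed.

(** Constants commute with the projection, so only the centered part of [F] contributes. *)
Lemma fibre_comm_centered F y : tame F -> L2 mu y ->
  fibre_comm F y = fun x => 'I (fun z => centered F z * y z) - centered F x * 'I y.
Proof.
move=> tF Ly; apply/funext => x; rewrite /fibre_comm cintegral_centered_mul //.
by rewrite /centered; ring.
Qed.

(** The inner commutator keeps of [y] only the numbers [y0] and [y1], giving [y1 - y0 f]; the outer
    one turns the constant into [- y1 F] and [- y0 f] into [- y0 cov], with [F] and [f] centered.
    Both numbers are parameters so that closed forms can be substituted in the induction. *)
Lemma fibre_comm_pair F f (y0 y1 : C) y : tame F -> tame f -> L2 mu y ->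
  y0 = 'I y -> y1 = 'I (fun x => centered f x * y x) ->
  fibre_comm F (fibre_comm f y) = fun x => - (fcov F f * y0 + centered F x * y1).
Proof.
move=> tF tf Ly -> ->; have tcF := tame_centered tF; have tcf := tame_centered tf.
set w := fibre_comm f y; set i1 := 'I _; set i2 := 'I _.
have wE : w = fun x => i2 * 1 + (- i1) * centered f x.
  by rewrite /w fibre_comm_centered //; apply/funext => x; rewrite mulr1 mulNr [i1 * _]mulrC.
have Lw : L2 mu w.
  rewrite wE; apply: L2_linear; first exact: (L2_cst mu 1).
  have := L2_linear (- i1) (tame_L2 tcf) (L2_cst mu 0).
  by under [X in L2 mu X -> _]eq_fun do rewrite addr0.
rewrite fibre_comm_centered //; apply/funext => x.
have -> : 'I w = i2.
  rewrite wE cintegral_comb; [|exact: (L2_cst mu 1)|exact: tame_L2].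
  by rewrite (cintegral_cst mu 1) cintegral_centered // mulr0 addr0 mulr1.
have -> : 'I (fun z => centered F z * w z) = - i1 * fcov F f.
  rewrite wE fcov_centered //.
  have -> : (fun z => centered F z * (i2 * 1 + - i1 * centered f z)) =
      fun z => i2 * centered F z + - i1 * (centered F z * centered f z).
    by apply/funext => z; ring.
  rewrite cintegral_comb; [|exact: tame_L2|exact: (tame_mul tcF (tame_L2 tcf))].
  by rewrite cintegral_centered // mulr0 add0r.
by ring.
Qed.

Definition fibre_chain (n : nat) (F : nat -> X -> C) : (X -> C) -> X -> C :=
  \big[(fun S T : (X -> C) -> X -> C => S \o T)/id]_(i < n) fibre_comm (F i).

(** Induction by pairs from the left. The formula for the remaining factors is a constant plus a
    multiple of [centered (F 2)]; the new pair extends both products by one covariance and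
    contributes one sign. *)
Lemma fibre_chainE k (F : nat -> X -> C) y : (forall i, tame (F i)) -> L2 mu y ->
  fibre_chain k.+1.*2 F y = fun x => (-1) ^+ k.+1 *
   ((\prod_(j < k.+1) fcov (F j.*2) (F j.*2.+1)) * 'I y + centered (F 0%N) x *
    ((\prod_(j < k) fcov (F j.*2.+1) (F j.*2.+2)) *
      'I (fun z => centered (F k.*2.+1) z * y z))).
Proof.
elim: k F => [|k IH] F tF Ly.
  rewrite /fibre_chain (_ : 1.*2 = 2)%N // !big_ord_recl !big_ord0 /=.
  rewrite (fibre_comm_pair (y := y) (tF 0%N) (tF 1%N) Ly erefl erefl).
  by apply/funext => x; rewrite !mulr1 mul1r mulN1r.
pose F2 i := F i.+2.
have tF2 i : tame (F2 i) by exact: tF.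
have -> : fibre_chain k.+2.*2 F y = fibre_comm (F 0%N) (fibre_comm (F 1%N) (fibre_chain k.+1.*2 F2 y)).
  by rewrite /fibre_chain (_ : k.+2.*2 = k.+1.*2.+2)%N // !big_ord_recl.
rewrite IH //; set A := \prod_(j < k.+1) _; set B := \prod_(j < k) _.
set i0 := 'I y; set i1 := 'I (fun z => _ z * y z).
set w := (fun x => _ * (_ + _)).
have tc := tame_centered (tF 2%N).
have wE : w = fun x => ((-1) ^+ k.+1 * (A * i0)) * 1 + ((-1) ^+ k.+1 * (B * i1)) * centered (F 2%N) x.
  by apply/funext => x; rewrite /w /F2; ring.
have Lw : L2 mu w.
  rewrite wE; apply: L2_linear; first exact: (L2_cst mu 1).
  have := L2_linear ((-1) ^+ k.+1 * (B * i1)) (tame_L2 tc) (L2_cst mu 0).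
  by under [X in L2 mu X -> _]eq_fun do rewrite addr0.
have Iw : (-1) ^+ k.+1 * (A * i0) = 'I w.
  rewrite wE cintegral_comb; [|exact: (L2_cst mu 1)|exact: tame_L2].
  by rewrite (cintegral_cst mu 1) cintegral_centered // mulr0 addr0 mulr1.
have tc1 := tame_centered (tF 1%N).
have I1w : (-1) ^+ k.+1 * (B * i1) * fcov (F 1%N) (F 2%N) =
    'I (fun z => centered (F 1%N) z * w z).
  rewrite wE fcov_centered //.
  have -> : (fun z => centered (F 1%N) z * ((-1) ^+ k.+1 * (A * i0) * 1 +
      (-1) ^+ k.+1 * (B * i1) * centered (F 2%N) z)) =
      fun z => ((-1) ^+ k.+1 * (A * i0)) * centered (F 1%N) z +
       ((-1) ^+ k.+1 * (B * i1)) * (centered (F 1%N) z * centered (F 2%N) z).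
    by apply/funext => z; ring.
  rewrite cintegral_comb; [|exact: tame_L2|exact: (tame_mul tc1 (tame_L2 tc))].
  by rewrite cintegral_centered // mulr0 add0r.
rewrite (fibre_comm_pair (tF 0%N) (tF 1%N) Lw Iw I1w); apply/funext => x.
have -> : \prod_(j < k.+2) fcov (F j.*2) (F j.*2.+1) = fcov (F 0%N) (F 1%N) * A.
  by rewrite big_ord_recl.
have -> : \prod_(j < k.+1) fcov (F j.*2.+1) (F j.*2.+2) = fcov (F 1%N) (F 2%N) * B.
  by rewrite big_ord_recl.
by rewrite [(-1) ^+ k.+2]exprS; ring.
Qed.

End fibre_commutators.

(** * Commutators with basic elements of the crossed product *)

Section crossed_product_operators.
Variables (R : realType) (G : groupType) (X : ptopologicalType).
Variables (act : G -> X -> X) (mu : probability (borel X) R).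
Hypothesis hact : action_by_homeo act.
Local Notation C := (cplx R).
Local Notation comm phi g := (commutator (projG mu) (lambda_mu act (basic phi g))).

Lemma actM g h x : act (g * h)%g x = act g (act h x).
Proof. by case: hact => _ ->. Qed.

Lemma lambda_basic (phi : X -> C) g (v : vec R G X) :
  lambda_mu act (basic phi g) v = fun h x => phi (act h x) * v (g^-1 * h)%g x.
Proof.
apply/funext => h; apply/funext => x; rewrite /lambda_mu.
have bE : basic phi g g = phi by rewrite /basic fsfunE inE eqxx.
have sub : (finsupp (basic phi g) `<=` [fset g])%fset.
  by apply/fsubsetP => k; rewrite mem_finsupp /basic fsfunE; case: ifP; rewrite ?eqxx.
(* When [phi] is the zero function the support is empty, and both sides are 0. *)
have [gin|gout] := boolP (g \in finsupp (basic phi g)).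
  have -> : finsupp (basic phi g) = [fset g]%fset.
    by apply/eqP; rewrite eqEfsubset sub fsub1set.
  by rewrite big_seq_fset1 bE /lambda_fun /translate /lambda_grp invgK.
have -> : finsupp (basic phi g) = fset0.
  apply/eqP; rewrite -fsubset0; apply/fsubsetP => k kin.
  have := fsubsetP sub k kin; rewrite inE => /eqP kg.
  by rewrite kg (negbTE gout) in kin.
rewrite big_seq_fset0; move: gout; rewrite memNfinsupp bE => /eqP ->.
by rewrite mul0r.
Qed.

Lemma commutator_basic (phi : X -> C) g (v : vec R G X) h :
  comm phi g v h = fibre_comm mu (fun x => phi (act h x)) (v (g^-1 * h)%g).
Proof. by apply/funext => x; rewrite /commutator !lambda_basic. Qed.

(** Each factor moves the coordinate by [g_i^-1] before the next one acts, so factor [i] works in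
    the fibre over [(g_0 ... g_(i-1))^-1 h]. This is the origin of the shifts in [psi_i]. *)
Lemma commutator_chain n (phi : 'I_n -> X -> C) (g : 'I_n -> G) (v : vec R G X) h :
  (\big[(fun S T : vec R G X -> vec R G X => S \o T)/id]_(i < n) comm (phi i) (g i)) v h =
  (\big[(fun S T : (X -> C) -> X -> C => S \o T)/id]_(i < n)
     fibre_comm mu (fun x => phi i (act ((\prod_(j < n | (j < i)%N) g j)^-1 * h)%g x)))
  (v ((\prod_(i < n) g i)^-1 * h)%g).
Proof.
elim: n phi g h => [|n IH] phi g h; first by rewrite !big_ord0 invg1 mul1g.
rewrite !big_ord_recl /= commutator_basic IH; congr fibre_comm.
  by apply/funext => x; rewrite big_pred0 // invg1 mul1g.
rewrite mulgA -invgM.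
rewrite (eq_bigr (fun i : 'I_n => fibre_comm mu (fun x => phi (lift ord0 i)
  (act ((\prod_(j < n.+1 | (j < bump 0 i)%N) g j)^-1 * h)%g x)))) // => i _.
congr fibre_comm; apply/funext => x.
by rewrite [in RHS]big_mkcond big_ord_recl /= -big_mkcond invgM mulgA.
Qed.

End crossed_product_operators.

(** * Covariances and deviations *)

Section ellp_products.
Variables (R : realType) (I : choiceType).

(** A summable family is bounded, say [s <= N], and then [s^m = s^(m-p) s^p <= N^(m-p) s^p]. *)
Lemma esum_pow_of_powR (s : I -> R) (p : R) (m : nat) : 0 < p -> p <= m%:R ->
  (forall i, 0 <= s i) ->
  (\esum_(i in [set: I]) (s i `^ p)%:E < +oo)%E ->
  (\esum_(i in [set: I]) (s i ^+ m)%:E < +oo)%E.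
Proof.
move=> p0 pm s0 fin; have sp0 i : 0 <= s i `^ p by exact: powR_ge0.
set M := rsum (fun i => s i `^ p); have M0 : 0 <= M by exact: rsum_ge0.
have sM i : s i <= M `^ p^-1.
  have -> : s i = (s i `^ p) `^ p^-1 by rewrite -powRrM divff ?powRr1 ?gt_eqF.
  apply: ge0_ler_powR; rewrite ?nnegrE ?invr_ge0 ?(ltW p0) //.
  exact: (le_rsum sp0 fin i).
set N := M `^ p^-1 in sM.
apply: (@esum_lty _ _ _ (fun i => N `^ (m%:R - p) * s i `^ p)); last first.
  by apply: esum_ltyZ => //; exact: powR_ge0.
move=> i; rewrite -powR_mulrn // -{1}(subrK p m%:R) powRD; last first.
  by rewrite subrK (gt_eqF (lt_le_trans p0 pm)).
rewrite ler_wpM2r //; apply: ge0_ler_powR; rewrite ?nnegrE ?subr_ge0 ?powR_ge0 //.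
Qed.

(** The product is at most a power of its largest factor. This crude bound stands in for Hölder's
    inequality, as only finiteness matters. *)
Lemma prod_le_sum_pow (m : nat) (s : 'I_m.+1 -> R) : (forall i, 0 <= s i) ->
  \prod_i s i <= \sum_i s i ^+ m.+1.
Proof.
move=> s0; have [i _ hi] := @Order.TotalTheory.arg_maxP _ _ _ ord0 predT s isT.
apply: (@le_trans _ _ (\prod_(j < m.+1) s i)).
  by apply: ler_prod => j _; rewrite s0; exact: hi.
rewrite prodr_const card_ord (bigD1 i) //= lerDl.
by apply: sumr_ge0 => j _; rewrite exprn_ge0.
Qed.

Lemma esum_prod_lty (m : nat) (s : nat -> I -> R) : (forall k i, 0 <= s k i) ->
  (forall k, (\esum_(i in [set: I]) (s k i ^+ m.+1)%:E < +oo)%E) ->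
  (\esum_(i in [set: I]) (\prod_(k < m.+1) s k i)%:E < +oo)%E.
Proof.
move=> s0 fin; apply: (@esum_lty _ _ _ (fun i => \sum_(k < m.+1) s k i ^+ m.+1)).
  by move=> i; exact: prod_le_sum_pow.
suff sums n : (\esum_(i in [set: I]) (\sum_(k < n) s k i ^+ m.+1)%:E < +oo)%E by exact: sums.
elim: n => [|n IH].
  by rewrite esum1 ?ltry // => i _; rewrite big_ord0.
under eq_esum do rewrite big_ord_recr.
apply: esum_ltyD; [|by move=> i; rewrite exprn_ge0|exact: IH|exact: fin].
by move=> i; apply: sumr_ge0 => k _; rewrite exprn_ge0.
Qed.

Lemma prod_pairs (m : nat) (f : nat -> R) :
  \prod_(k < m) (f k.*2 * f k.*2.+1) = \prod_(k < m.*2) f k.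
Proof.
elim: m => [|m IH]; first by rewrite !big_ord0.
by rewrite doubleS !big_ord_recr /= IH mulrA.
Qed.

(** The pairs [(1,2), (3,4), ...] leave out the two ends 0 and [2m+1], which form the cyclic
    pair. *)
Lemma prod_pairs_shifted (m : nat) (f : nat -> R) :
  f 0%N * f m.*2.+1 * \prod_(k < m) (f k.*2.+1 * f k.*2.+2) = \prod_(k < m.+1.*2) f k.
Proof.
rewrite (prod_pairs m (fun k => f k.+1)) doubleS big_ord_recl big_ord_recr /=.
by rewrite -mulrA; congr (_ * _); rewrite mulrC.
Qed.

End ellp_products.

(** * Covariance and deviation as integrals over a fibre *)

Section fibres_of_functions.
Variables (R : realType) (G : groupType) (X : ptopologicalType).
Variables (act : G -> X -> X) (mu : probability (borel X) R).
Hypothesis cX : compact [set: X].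
Hypothesis hact : action_by_homeo act.
Local Notation C := (cplx R).

(** The translate [h^-1 . phi], by which [lambda_mu] multiplies the coordinate at [h]. *)
Definition fibre (phi : X -> C) (h : G) : X -> C := fun x => phi (act h x).

Lemma tame_fibre (phi : X -> C) h : continuous phi -> tame (fibre phi h).
Proof.
move=> cphi; have cf : continuous (fibre phi h).
  by case: hact => _ _ ca x; apply: continuous_comp; [exact: ca | exact: cphi].
split; first exact: continuous_cmeas.
exact: continuous_cbounded.
Qed.

Lemma expGE (phi : X -> C) h : expG act mu phi h = cintegral mu (fibre phi h).
Proof. by rewrite /expG /translate invgK. Qed.

Lemma covGE (phi psi : X -> C) h :
  covG act mu phi (cconj psi) h = fcov mu (fibre phi h) (fibre psi h).
Proof.
have -> : cconj psi = fun x => (psi x)^* by [].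
rewrite /covG !expGE /fcov /fibre /cconj.
have -> : (fun x => (psi (act h x))^*^*) = (fun x => psi (act h x)).
  by apply/funext => x; rewrite conjCK.
by under eq_fun do rewrite conjCK.
Qed.

Lemma nsq_centered (F : X -> C) : tame F ->
  rc (nsq mu (centered mu F)) = cintegral mu (fun x => `|F x| ^+ 2) - `|cintegral mu F| ^+ 2.
Proof.
move=> tF; set m := cintegral mu F; have LF := tame_L2 mu tF.
have -> : cintegral mu (fun x => `|F x| ^+ 2) = rc (nsq mu F).
  by rewrite -ip_nsq; congr cintegral; apply/funext => x; rewrite normCK.
have -> : centered mu F = fun x => 1 * F x + - m by apply/funext => x; rewrite mul1r.
rewrite nsq_linear //; last exact: (L2_cst mu (- m)).
have -> : nsq mu (fun=> - m) = cabs m ^+ 2.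
  apply: rc_inj; rewrite -ip_nsq /ip (cintegral_cst mu (- m * (- m)^*)).
  by rewrite mul_conj cabsN.
have -> : ip mu F (fun=> - m) = - rc (cabs m ^+ 2).
  rewrite /ip; under eq_fun do rewrite mulrC.
  by rewrite (cintegralZ _ (L2_cintegrable LF)) -/m conjN mulNr mulrC mul_conj.
rewrite cabs1 mulrN mul1r reN re_rc normcE -rcX -rcN -rcD; congr rc.
by ring.
Qed.

(** The complex square root in [devG] is taken of a variance, hence of a nonnegative real number. *)
Lemma devG_sqr (phi : X -> C) h : continuous phi ->
  cabs (devG act mu phi h) ^+ 2 = nsq mu (centered mu (fibre phi h)).
Proof.
move=> cphi; rewrite -cabsX /devG sqrtCK !expGE.
rewrite [fibre (fun x => _) h]/fibre -(nsq_centered (tame_fibre h cphi)).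
by rewrite cabs_rc ger0_norm // nsq_ge0.
Qed.

Lemma sqrt_nsq_centered (phi : X -> C) h : continuous phi ->
  Num.sqrt (nsq mu (centered mu (fibre phi h))) = cabs (devG act mu phi h).
Proof. by move=> cphi; rewrite -devG_sqr // sqrtr_sqr ger0_norm // cabs_ge0. Qed.

(** [fcov] is bilinear, so Cauchy-Schwarz is applied to the conjugate of the second centered
    function, which has the same norm. *)
Lemma cabs_fcov_le (phi psi : X -> C) h k : continuous phi -> continuous psi ->
  cabs (fcov mu (fibre phi h) (fibre psi k)) <=
  cabs (devG act mu phi h) * cabs (devG act mu psi k).
Proof.
move=> c1 c2; have t1 := tame_fibre h c1; have t2 := tame_fibre k c2.
rewrite fcov_centered // -!sqrt_nsq_centered //.
have L1 := tame_L2 mu (tame_centered mu t1).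
have L2c := tame_L2 mu (tame_conj (tame_centered mu t2)).
have := ip_cauchy_schwarz_sqrt L1 L2c.
rewrite (@nsq_eq _ _ mu (fun x => (centered mu (fibre psi k) x)^*) (centered mu (fibre psi k))) => [|x]; last by rewrite cabs_conj.
rewrite /ip.
by under eq_fun do rewrite conjCK.
Qed.

End fibres_of_functions.

Section translates.
Variables (R : realType) (G : groupType) (X : ptopologicalType).
Variables (act : G -> X -> X) (mu : probability (borel X) R).
Hypothesis hact : action_by_homeo act.
Local Notation C := (cplx R).

Lemma continuous_translate (phi : X -> C) g : continuous phi -> continuous (translate act g phi).
Proof.
move=> cphi x; case: hact => _ _ ca.
by apply: continuous_comp; [exact: ca | exact: cphi].
Qed.

Lemma fibre_translate (phi : X -> C) g h :
  fibre act (translate act g phi) h = fibre act phi (g^-1 * h)%g.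
Proof. by apply/funext => x; rewrite /fibre /translate actM. Qed.

Lemma devG_translate (phi : X -> C) g h :
  devG act mu (translate act g phi) h = devG act mu phi (g^-1 * h)%g.
Proof.
rewrite /devG !expGE fibre_translate.
by rewrite (fibre_translate (fun x => `|phi x| ^+ 2) g h).
Qed.

(** Translating a function translates its deviation on [G], and left translation permutes [G]. *)
Lemma devG_translate_fin (phi : X -> C) g (p : R) : ellp p (devG act mu phi) ->
  (\esum_(h in [set: G]) (cabs (devG act mu (translate act g phi) h) `^ p)%:E < +oo)%E.
Proof.
move=> fin; have tb : set_bij [set: G] [set: G] (fun h => g^-1 * h)%g.
  split=> //; first by move=> x y _ _; apply: mulgI.
  by move=> y _; exists (g * y)%g => //; rewrite mulKg.
have E := @reindex_esum R G G _ _ _ (fun h => (re `|devG act mu phi h| `^ p)%:E) tb.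
have fin' := eq_ind _ (fun z => (z < +oo)%E) fin _ E.
by apply: esum_lty fin' => h; rewrite devG_translate.
Qed.

End translates.

(** * The Chern character *)

Section chern_operator_fibres.
Variables (R : realType) (G : groupType) (X : ptopologicalType).
Variables (act : G -> X -> X) (mu : probability (borel X) R).
Hypothesis cX : compact [set: X].
Hypothesis hact : action_by_homeo act.
Local Notation C := (cplx R).
(** Here [n = 2k + 1], so there are [k.*2.+2] functions, [k.+1] covariances in the first product,
    and [k] plus the cyclic one in the second. *)
Variables (k : nat) (phi : 'I_k.*2.+2 -> X -> C) (g : 'I_k.*2.+2 -> G).
Hypothesis cphi : forall i, continuous (phi i).

Let F i h : X -> C := fibre act (shifted act phi g i) h.
Let c i j h : C := fcov mu (F i h) (F j h).
Let A h := \prod_(j < k.+1) c j.*2 j.*2.+1 h.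
Let B h := \prod_(j < k) c j.*2.+1 j.*2.+2 h.
Let gt := (\prod_(i < k.*2.+2) g i)%g.

Lemma tame_shifted i h : tame (F i h).
Proof. by apply: tame_fibre => //; exact: continuous_translate. Qed.

(** Scalars are absorbed into the range functions. The second functional is a conjugate because [ip]
    conjugates its second argument while the covariance is bilinear; the minus sign of the second
    term comes from [symG], which negates functions of mean zero. *)
Lemma chern_operator_fibre (v : vec R G X) : ell2 mu v ->
  chern_operator act mu (fun i => basic (phi i) (g i)) v =
  add_op (rank_one_sum mu (fun h => gt^-1 * h)%g (fun h _ => (-1) ^+ k.+1 * A h) (fun _ _ => 1))
    (rank_one_sum mu (fun h => gt^-1 * h)%g
       (fun h x => - ((-1) ^+ k.+1 * B h) * centered mu (F 0%N h) x)
       (fun h x => (centered mu (F k.*2.+1 h) x)^*)) v.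
Proof.
move=> /ell2P[Lv _]; rewrite /chern_operator /=; set psi := (X in symG _ X).
have psiE h : psi h = fibre_chain mu k.+1.*2 (F ^~ h) (v (gt^-1 * h)%g).
  rewrite /psi commutator_chain //.
  rewrite (eq_bigr (fun i : 'I_k.*2.+2 => fibre_comm mu (F i h))) // => i _.
  congr fibre_comm; apply/funext => x.
  by rewrite /F /fibre /shifted /translate inord_val actM.
apply/funext => h; set y := v (gt^-1 * h)%g; have Ly : L2 mu y by exact: Lv.
have tF i := tame_shifted i h.
set i0 := cintegral mu y.
set i1 := cintegral mu (fun z => centered mu (F k.*2.+1 h) z * y z).
have E x : psi h x = (-1) ^+ k.+1 * A h * i0 * 1 + (-1) ^+ k.+1 * B h * i1 * centered mu (F 0%N h) x.
  by rewrite psiE (fibre_chainE k tF Ly) -/i0 -/i1 /A /B; ring.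
apply/funext => x; rewrite /symG /projG.
have -> : cintegral mu (psi h) = (-1) ^+ k.+1 * A h * i0.
  rewrite (_ : psi h = fun x => (-1) ^+ k.+1 * A h * i0 * 1 + (-1) ^+ k.+1 * B h * i1 * centered mu (F 0%N h) x); last exact/funext.
  rewrite cintegral_comb; [|exact: (L2_cst mu 1)|exact: (tame_L2 mu (tame_centered mu (tF 0%N)))].
  by rewrite (cintegral_cst mu 1) cintegral_centered // mulr0 addr0 mulr1.
rewrite E /add_op /rank_one_sum ip1 -/y -/i0.
have -> : ip mu y (fun x => (centered mu (F k.*2.+1 h) x)^*) = i1.
  by rewrite /ip /i1; congr cintegral; apply/funext => z; rewrite conjCK mulrC.
by rewrite mulr2n; ring.
Qed.

Variable p : R.
Hypothesis p1 : 1 <= p.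
Hypothesis pn : p < k.*2.+2%:R.
Hypothesis phip : forall i, ellp p (devG act mu (phi i)).

Let sg i h := cabs (devG act mu (shifted act phi g i) h).

Let cF i : continuous (shifted act phi g i).
Proof. exact: continuous_translate. Qed.

Lemma cabs_cov_le i j h : cabs (c i j h) <= sg i h * sg j h.
Proof. exact: cabs_fcov_le. Qed.

Let sg0 i h : 0 <= sg i h. Proof. exact: cabs_ge0. Qed.

Lemma deviations_product_fin : (\esum_(h in [set: G]) (\prod_(i < k.*2.+2) sg i h)%:E < +oo)%E.
Proof.
(* [sg i] makes sense for every natural number [i], as [inord] sends those out of range to 0. *)
apply: esum_prod_lty => // i.
apply: (esum_pow_of_powR (p := p)) => //; first exact: lt_le_trans p1.
  exact: ltW.
exact: devG_translate_fin.
Qed.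

Lemma cabs_even_product_le h : cabs (A h) <= \prod_(i < k.*2.+2) sg i h.
Proof.
rewrite /A prod_cabs -(prod_pairs k.+1 (fun i => sg i h)).
by apply: ler_prod => j _; rewrite cabs_ge0 cabs_cov_le.
Qed.

(** The two end deviations are the norms of the outer centered functions, so this one bound controls
    both the rank one norms in [fin'] and the terms of the second sum. *)
Lemma cabs_odd_product_le h : sg 0%N h * sg k.*2.+1 h * cabs (B h) <= \prod_(i < k.*2.+2) sg i h.
Proof.
rewrite -(prod_pairs_shifted k (fun i => sg i h)) ler_wpM2l ?mulr_ge0 //.
by rewrite /B prod_cabs; apply: ler_prod => j _; rewrite cabs_ge0 cabs_cov_le.
Qed.

Lemma even_products_summable : asummable A.
Proof. exact: asummable_le cabs_even_product_le deviations_product_fin. Qed.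

Lemma odd_products_summable : asummable (fun h => c k.*2.+1 0%N h * B h).
Proof.
apply: asummable_le deviations_product_fin => h; apply: le_trans (cabs_odd_product_le h).
by rewrite cabsM ler_wpM2r ?cabs_ge0 // mulrC cabs_cov_le.
Qed.

Let u h : X -> C := fun=> (-1) ^+ k.+1 * A h.
Let w (h : G) : X -> C := fun=> 1.
Let u' h : X -> C := fun x => - ((-1) ^+ k.+1 * B h) * centered mu (F 0%N h) x.
Let w' h : X -> C := fun x => (centered mu (F k.*2.+1 h) x)^*.

Let tc i h : tame (centered mu (F i h)).
Proof. exact/tame_centered/tame_shifted. Qed.

Let Lu h : L2 mu (u h). Proof. exact: (L2_cst mu). Qed.
Let Lw h : L2 mu (w h). Proof. exact: (L2_cst mu). Qed.
Let Lu' h : L2 mu (u' h).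
Proof.
have := L2_linear (- ((-1) ^+ k.+1 * B h)) (tame_L2 mu (tc 0%N h)) (L2_cst mu 0).
by under [X in L2 mu X -> _]eq_fun do rewrite addr0.
Qed.
Let Lw' h : L2 mu (w' h). Proof. exact: (tame_L2 mu (tame_conj (tc _ h))). Qed.

Let uu' h : ip mu (u h) (u' h) = 0.
Proof.
rewrite ip_conj // /ip.
have -> : (fun x => u' h x * (u h x)^*) = fun x =>
    (- ((-1) ^+ k.+1 * B h) * ((-1) ^+ k.+1 * A h)^*) * centered mu (F 0%N h) x.
  by apply/funext => x; rewrite /u' /u mulrAC.
rewrite cintegralZ; last exact/L2_cintegrable/tame_L2.
by rewrite cintegral_centered ?mulr0 ?conjC0 //; exact: tame_shifted.
Qed.

Let ww' h : ip mu (w h) (w' h) = 0.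
Proof.
rewrite ip_conj // ip1 cintegral_conj; last exact/L2_cintegrable/tame_L2.
by rewrite cintegral_centered ?conjC0 //; exact: tame_shifted.
Qed.

Let cabs_sign : cabs ((-1) ^+ k.+1 : C) = 1.
Proof. by rewrite cabsX cabsN cabs1 expr1n. Qed.

Let fin : (\esum_(h in [set: G])
  (Num.sqrt (nsq mu (u h)) * Num.sqrt (nsq mu (w h)))%:E < +oo)%E.
Proof.
apply: esum_lty even_products_summable => h.
have -> : nsq mu (u h) = cabs (A h) ^+ 2.
  apply: rc_inj; rewrite -ip_nsq /ip.
  rewrite (cintegral_cst mu (((-1) ^+ k.+1 * A h) * ((-1) ^+ k.+1 * A h)^*)).
  by rewrite mul_conj cabsM cabs_sign mul1r.
by rewrite nsq_cst1 sqrtr1 mulr1 sqrtr_sqr ger0_norm ?cabs_ge0.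
Qed.

Let fin' : (\esum_(h in [set: G])
  (Num.sqrt (nsq mu (u' h)) * Num.sqrt (nsq mu (w' h)))%:E < +oo)%E.
Proof.
apply: esum_lty deviations_product_fin => h; apply: le_trans (cabs_odd_product_le h).
have -> : nsq mu (u' h) = cabs (B h) ^+ 2 * nsq mu (centered mu (F 0%N h)).
  by rewrite nsqZ ?cabsN ?cabsM ?cabs_sign ?mul1r //; exact: tame_L2.
rewrite (@nsq_eq _ _ mu (w' h) (centered mu (F k.*2.+1 h))); last by move=> x; exact: cabs_conj.
have sgE i : Num.sqrt (nsq mu (centered mu (F i h))) = sg i h by exact: sqrt_nsq_centered.
have -> : Num.sqrt (cabs (B h) ^+ 2 * nsq mu (centered mu (F 0%N h))) = cabs (B h) * sg 0%N h.
  rewrite (sqrtrM (nsq mu (centered mu (F 0%N h))) (sqr_ge0 (cabs (B h)))).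
  congr (_ * _); last exact: sgE.
  by rewrite sqrtr_sqr ger0_norm ?cabs_ge0.
rewrite (sgE k.*2.+1) le_eqVlt; apply/orP; left; apply/eqP.
by rewrite [RHS]mulrC mulrA.
Qed.

Let st : cancel (fun h => gt^-1 * h)%g (fun h => gt * h)%g.
Proof. by move=> h; rewrite mulgA mulgV mul1g. Qed.
Let ts : cancel (fun h => gt * h)%g (fun h => gt^-1 * h)%g.
Proof. by move=> h; rewrite mulgA mulVg mul1g. Qed.

Lemma chern_operator_trace_class :
  trace_class mu (chern_operator act mu (fun i => basic (phi i) (g i))).
Proof. exact: (two_terms_trace_class st ts Lu Lw Lu' Lw' uu' ww' fin fin' chern_operator_fibre). Qed.

Let chernE : chern act mu (fun i => basic (phi i) (g i)) =
  csum (fun h => if (gt^-1 * h)%g == h then ip mu (u h) (w h) else 0) +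
  csum (fun h => if (gt^-1 * h)%g == h then ip mu (u' h) (w' h) else 0).
Proof. exact: (two_terms_trace st ts Lu Lw Lu' Lw' fin fin' chern_operator_fibre). Qed.

(** Translation by a nontrivial element has no fixed point, so both sums in [chernE] run over
    zeros. *)
Lemma chern_off_identity : gt <> 1%g ->
  chern act mu (fun i => basic (phi i) (g i)) = 0.
Proof.
move=> gt1; have nh h : ((gt^-1 * h)%g == h) = false.
  apply/negP => /eqP E; apply: gt1; apply: (can_inj invgK); apply: (mulIg h).
  by rewrite E invg1 mul1g.
rewrite chernE; under eq_fun do rewrite nh; under [X in _ + csum X]eq_fun do rewrite nh.
by rewrite csum0 addr0.
Qed.

Lemma chern_identity : gt = 1%g ->
  (-1) ^+ k.+1 * chern act mu (fun i => basic (phi i) (g i)) =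
  csum A - csum (fun h => c k.*2.+1 0%N h * B h).
Proof.
move=> gt1; have eh h : ((gt^-1 * h)%g == h) by rewrite gt1 invg1 mul1g.
have sgn2 : (-1) ^+ k.+1 * (-1) ^+ k.+1 = 1 :> C by rewrite -exprMn mulrNN mulr1 expr1n.
rewrite chernE; under eq_fun do rewrite eh; under [X in _ + csum X]eq_fun do rewrite eh.
have -> : (fun h => ip mu (u h) (w h)) = fun h => (-1) ^+ k.+1 * A h.
  by apply/funext => h; rewrite ip1 cintegral_cst.
have -> : (fun h => ip mu (u' h) (w' h)) = fun h => - (-1) ^+ k.+1 * (c k.*2.+1 0%N h * B h).
  apply/funext => h; have t0 := tame_shifted 0%N h; have tn := tame_shifted k.*2.+1 h.
  (* The operator pairs index 0 with index n, the formula n with 0; [fcov] is symmetric. *)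
  rewrite /ip /c fcovC fcov_centered //.
  have -> : (fun x => u' h x * (w' h x)^*) = fun x => - ((-1) ^+ k.+1 * B h) *
      (centered mu (F 0%N h) x * centered mu (F k.*2.+1 h) x).
    by apply/funext => x; rewrite /u' /w' conjCK mulrA.
  rewrite cintegralZ; last first.
    exact/L2_cintegrable/tame_mul/tame_L2.
  by ring.
rewrite (csumZ _ even_products_summable) (csumZ _ odd_products_summable) mulrDr mulrA sgn2 mul1r.
by rewrite mulrA mulrN sgn2 mulN1r.
Qed.

End chern_operator_fibres.

Theorem proposition2p11 (R : realType) (G : groupType) (X : ptopologicalType)
    (act : G -> X -> X) (mu : probability (borel X) R)
    (p : R) (n : nat) (phi : 'I_n.+1 -> X -> cplx R) (g : 'I_n.+1 -> G) :
  compact [set: X] -> metrizable R X -> action_by_homeo act ->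
  1 <= p -> full_support mu -> ellp_deviation act mu p ->
  odd n -> p < n.+1%:R ->
  (forall i, Ap act mu p (phi i)) ->
  let a := fun i => basic (phi i) (g i) in
  let psi := shifted act phi g in
  let cov := fun i j => covG act mu (psi i) (cconj (psi j)) in
  let F := fun h => \prod_(k < n.+1./2) cov k.*2 k.*2.+1 h in
  let F' := fun h => cov n 0%N h * \prod_(k < n./2) cov k.*2.+1 k.*2.+2 h in
  [/\ trace_class mu (chern_operator act mu a),
      (\prod_(i < n.+1) g i)%g <> 1%g -> chern act mu a = 0 &
      (\prod_(i < n.+1) g i)%g = 1%g ->
      [/\ csummable F, csummable F' &
          (-1) ^+ n.+1./2 * chern act mu a = csum F - csum F']].
Proof.
move=> cX _ hact p1 _ _ nodd.
(* The types of [phi] and [g] depend on [n], so oddness is turned into an equation that can be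
   substituted. *)
have [k nE] : exists k, n = k.*2.+1.
  by exists n./2; rewrite -{1}(odd_double_half n) nodd.
subst n => pn phiAp.
have cphi i : continuous (phi i) by case: (phiAp i).
have phip i : ellp p (devG act mu (phi i)) by case: (phiAp i).
have half1 : k.*2.+2./2 = k.+1 by rewrite -doubleS doubleK.
have half0 : k.*2.+1./2 = k by rewrite /= uphalf_double.
move=> a psi cov F F'.
have covE i j h : cov i j h = fcov mu (fibre act (psi i) h) (fibre act (psi j) h).
  exact: covGE.
have FE : F = fun h => \prod_(j < k.+1) fcov mu (fibre act (psi j.*2) h) (fibre act (psi j.*2.+1) h).
  by apply/funext => h; rewrite /F half1; apply: eq_bigr => j _; rewrite covE.
have F'E : F' = fun h => fcov mu (fibre act (psi k.*2.+1) h) (fibre act (psi 0%N) h) *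
    \prod_(j < k) fcov mu (fibre act (psi j.*2.+1) h) (fibre act (psi j.*2.+2) h).
  apply/funext => h; rewrite /F' half0 covE; congr (_ * _).
  by apply: eq_bigr => j _; rewrite covE.
split.
- exact: (chern_operator_trace_class cX hact g cphi p1 pn phip).
- exact: (chern_off_identity cX hact cphi p1 pn phip).
move=> g1; rewrite half1 FE F'E; split.
- by eexists; exact: (asummable_csum (even_products_summable cX hact g cphi p1 pn phip)).
- by eexists; exact: (asummable_csum (odd_products_summable cX hact g cphi p1 pn phip)).
exact: (chern_identity cX hact cphi p1 pn phip).
Qed.
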